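(* Let $\bar\ell:\mathbb{R}^d\to\mathbb{R}$ be twice continuously differentiable and let $0<\delta\le M$ be such that $\delta I\preccurlyeq\nabla^2\bar\ell(\theta)\preccurlyeq MI$ for all $\theta\in\mathbb{R}^d$. For $(m,C)\in\Omega$ let $$\mathcal{L}(m,C)=\mathbb{E}_{\theta\sim\mathcal{N}(m,CC^\top)}\big[\bar\ell(\theta)+\log q_{(m,C)}(\theta)\big],$$ where $q_{(m,C)}$ is the density of $\mathcal{N}(m,CC^\top)$, and let $(m_*,C_* )\in\Omega$ be the minimizer of $\mathcal{L}$ over $\Omega$. Let $m_0\in\mathbb{R}^d$, $C_0=c_0I$ with $c_0>0$, let $\rho>0$, and let $(m_t,C_t)\in\Omega$, $t=0,1,2,\dots$, be generated by $$C_{t+1}=C_t-\rho\,C_t\,\mathrm{tril}\big[C_t^\top H_tC_t-I\big],\qquad m_{t+1}=m_t-\rho\,C_tC_t^\top g_t,$$ where $g_t=\mathbb{E}_{\theta\sim\mathcal{N}(m_t,C_tC_t^\top)}[\nabla\bar\ell(\theta)]$ and $H_t=\mathbb{E}_{\theta\sim\mathcal{N}(m_t,C_tC_t^\top)}[\nabla^2\bar\ell(\theta)]$. Assume that there are constants $0<\xi_l\le\xi_u<\infty$ and $\lambda_{\min}>0$ such that $\xi_l\le\|C_t\|_F\le\xi_u$ and $C_tC_t^\top\succcurlyeq\lambda_{\min}I$ for all $t\ge0$. Let $$\eta=\min\Big\{\lambda_{\min}\rho-\frac{M\rho^2\xi_u^4}{2},\ \sqrt{\tfrac52}\,\rho\,\xi_l^2-\frac{5\rho^2\xi_u^4M}{4}\Big\},$$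 and assume that the step size $\rho$ is such that $0<1-2\eta\delta<1$. Then for all integers $t\ge0$, $$\mathcal{L}(m_{t+1},C_{t+1})-\mathcal{L}(m_*,C_* )\le(1-2\eta\delta)^{t+1}\big(\mathcal{L}(m_0,C_0)-\mathcal{L}(m_*,C_* )\big).$$
   Context: $\Omega$ is the set of pairs $(m,C)$ with $m\in\mathbb{R}^d$ and $C\in\mathbb{R}^{d\times d}$ lower triangular with positive diagonal entries (so $V=CC^\top\succ0$). For a square matrix $A$, $\mathrm{tril}[A]$ is the lower-triangular matrix with entries $A_{ij}$ for $i>j$, $\tfrac12A_{ii}$ for $i=j$, and $0$ for $i<j$. $\|\cdot\|_F$ is the Frobenius norm and $\succcurlyeq$, $\preccurlyeq$ the Loewner order. The iteration is the square-root variational Newton (SR-VN) algorithm with constant step size. The minimizer $(m_*,C_* )$ satisfies $\mathbb{E}_{\theta\sim\mathcal{N}(m_*,V_* )}[\nabla\bar\ell(\theta)]=0$ and $V_*^{-1}=\mathbb{E}_{\theta\sim\mathcal{N}(m_*,V_* )}[\nabla^2\bar\ell(\theta)]$ with $V_*=C_*C_*^\top$. *)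

(* Defs.v *)
From HB Require Import structures.
From mathcomp Require Import all_boot all_order all_algebra.
From mathcomp Require Import all_classical all_reals all_analysis.

Set Implicit Arguments.
Unset Strict Implicit.
Unset Printing Implicit Defensive.

Import Order.TTheory GRing.Theory Num.Theory.
Import numFieldNormedType.Exports.

Local Open Scope classical_set_scope.
Local Open Scope ring_scope.

(* Lebesgue measure on R^d.  MathComp-Analysis puts the product sigma-algebra
   on [d.-tuple R] but no product measure, so it is built here by recursion
   on d, transporting [lebesgue_measure \x mu] along [cons]. *)
Section tuple_cons_measure.
Context {R : realType} {n : nat}.
Variable mu : {sigma_finite_measure set (n.-tuple R) -> \bar R}.

Definition cons_pair (x : measurableTypeR R * n.-tuple R) : n.+1.-tuple R :=
  [tuple of x.1 :: x.2].

Lemma measurable_cons_pair : measurable_fun setT cons_pair.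
Proof. exact: (measurable_cons measurable_fst measurable_snd). Qed.

Definition cons_measure : set (n.+1.-tuple R) -> \bar R :=
  pushforward (@lebesgue_measure R \x mu)%E cons_pair.

Let cons_measure0 : cons_measure set0 = 0%E.
Proof. by rewrite /cons_measure /pushforward preimage_set0 measure0. Qed.

Let measurable_cons_preimage A :
  measurable A -> measurable (cons_pair @^-1` A).
Proof.
by move=> mA; rewrite -[X in measurable X]setTI; exact: measurable_cons_pair.
Qed.

Let cons_measure_ge0 A : (0 <= cons_measure A)%E.
Proof. exact: (measure_ge0 (_ \x _)%E). Qed.

Let cons_measure_sigma_additive : semi_sigma_additive cons_measure.
Proof.
move=> F mF tF mUF; rewrite /cons_measure /pushforward preimage_bigcup.
apply: measure_semi_sigma_additive.
- by move=> i; exact: measurable_cons_preimage.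
- apply/trivIsetP => /= i j _ _ ij; rewrite -preimage_setI.
  by move/trivIsetP : tF => /(_ _ _ _ _ ij) ->//; rewrite preimage_set0.
- by rewrite -preimage_bigcup; exact: measurable_cons_preimage.
Qed.

HB.instance Definition _ := isMeasure.Build _ _ _ cons_measure
  cons_measure0 cons_measure_ge0 cons_measure_sigma_additive.

Lemma sigma_finite_cons_measure : sigma_finite setT cons_measure.
Proof.
have /sigma_finiteP[F [TF ndF Foo]] := sigma_finiteT (@lebesgue_measure R).
have /sigma_finiteP[G [TG ndG Goo]] := sigma_finiteT mu.
pose uncons (t : n.+1.-tuple R) : measurableTypeR R * n.-tuple R :=
  (thead t, [tuple of behead t]).
have muncons : measurable_fun setT uncons.
  apply/measurable_fun_pairP; split => /=.
    exact: (measurable_tnth ord0).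
  exact: measurable_behead.
exists (fun k => uncons @^-1` (F k `*` G k)).
  rewrite -preimage_bigcup -[LHS](preimage_setT uncons); congr (_ @^-1` _).
  rewrite -setXTT TF TG predeqE => -[x y]; split.
    move=> [/= [i _ Fix] [k _ Gky]]; exists (maxn i k) => //; split.
    - by move: x Fix; exact/subsetPset/ndF/leq_maxl.
    - by move: y Gky; exact/subsetPset/ndG/leq_maxr.
  by move=> [i _ []/= ? ?]; split; exists i.
move=> k; have [mF Fk] := Foo k; have [mG Gk] := Goo k; split.
  rewrite -[X in measurable X]setTI; apply: muncons => //.
  exact: measurableX.
rewrite /cons_measure /pushforward -comp_preimage (_ : uncons \o _ = id).
  by rewrite preimage_id product_measure1E// lte_mul_pinfty// ge0_fin_numE.
apply/funext => -[x t]; rewrite /uncons/=; congr pair.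
exact/val_inj.
Qed.

HB.instance Definition _ := @Measure_isSigmaFinite.Build _ _ _
  cons_measure sigma_finite_cons_measure.

End tuple_cons_measure.

Fixpoint lebesgue_tuple {R : realType} (d : nat) :
    {sigma_finite_measure set (d.-tuple R) -> \bar R} :=
  if d is n.+1 then cons_measure (lebesgue_tuple n) else \d_[tuple].

Section definitions.
Context {R : realType} {d : nat}.
Implicit Types (m : 'cV[R]_d) (A B C V : 'M[R]_d).

Definition cV_of_tuple (t : d.-tuple R) : 'cV[R]_d := \col_i tnth t i.

Definition gauss_pdf m V (theta : 'cV[R]_d) : R :=
  (Num.sqrt ((2 * pi) ^+ d * \det V))^-1 *
  expR (- (1 / 2) * ((theta - m)^T *m invmx V *m (theta - m)) 0 0).

(* Expectation of f under N(m, V), whose density is [gauss_pdf m V];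
   meaningful only for V positive definite. *)
Definition gauss_E m V (f : 'cV[R]_d -> R) : R :=
  \int[lebesgue_tuple d]_t
    (f (cV_of_tuple t) * gauss_pdf m V (cV_of_tuple t)).

Definition gauss_E_mx m V {p q : nat} (F : 'cV[R]_d -> 'M[R]_(p, q)) :
    'M[R]_(p, q) :=
  \matrix_(i, j) gauss_E m V (fun theta => F theta i j).

Definition grad (f : 'cV[R]_d -> R) (x : 'cV[R]_d) : 'cV[R]_d :=
  \col_i 'D_(delta_mx i 0) f x.

Definition hess (f : 'cV[R]_d -> R) (x : 'cV[R]_d) : 'M[R]_d :=
  \matrix_(i, j) 'D_(delta_mx j 0) (fun y => 'D_(delta_mx i 0) f y) x.

Definition C2 (f : 'cV[R]_d -> R) : Prop :=
  [/\ forall x, differentiable f x,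
      forall x, differentiable (grad f) x &
      continuous (hess f)].

(* Symmetry is not built in: the order is only used between symmetric matrices
   (Hessians of C^2 functions, C C^T, multiples of I). *)
Definition loewner_le A B : Prop :=
  forall x : 'cV[R]_d, 0 <= (x^T *m (B - A) *m x) 0 0.

Definition frobenius_norm A : R :=
  Num.sqrt (\sum_(i < d) \sum_(j < d) A i j ^+ 2).

Definition tril A : 'M[R]_d :=
  \matrix_(i, j)
    if (j < i)%N then A i j else if i == j then A i j / 2 else 0.

Definition Omega : set ('cV[R]_d * 'M[R]_d) :=
  [set p | is_trig_mx p.2 /\ forall i, 0 < p.2 i i].

Definition VI_loss (l : 'cV[R]_d -> R) (p : 'cV[R]_d * 'M[R]_d) : R :=
  gauss_E p.1 (p.2 *m p.2^T)
    (fun theta => l theta + ln (gauss_pdf p.1 (p.2 *m p.2^T) theta)).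

End definitions.

(* Main.v *)
Require Import Defs.
From HB Require Import structures.
From mathcomp Require Import all_boot all_order all_algebra.
From mathcomp Require Import all_classical all_reals all_analysis.
From mathcomp Require Import measurable_realfun ring lra.
Set Implicit Arguments.
Unset Strict Implicit.
Unset Printing Implicit Defensive.
Import Order.TTheory GRing.Theory Num.Theory.
Import numFieldNormedType.Exports.
Local Open Scope classical_set_scope.
Local Open Scope ring_scope.

(* Up to a constant, L(m, C) = e(m, C) - ln det C with
   e(m, C) = E[l(m + C z)], z standard Gaussian.  Stein's identity
   E[z_j u(z)] = E[d_j u(z)], obtained by differentiating E[u(z + h e_j)] in h,
   shows that the partial gradients of e are g and the lower triangle of H C,
   and the pointwise Taylor bounds on l make e delta-strongly convex and
   M-smooth.

   The barrier - ln det C is not smooth, so it is handled exactly.  Let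
   S = C^T H C - I, T = tril S, Q = <S, T>, lam = lambda_min, U = xi_u^2.
   - Writing C' = C (I - X), the convexity bound is a sum of scalar conjugates
     and yields 2 delta (L(m, C) - L(m', C')) <= |g|^2 + Q / lam for every
     (m', C') in Omega, provided delta lam <= 1.
   - Since C_(t+1) = C_t (I - rho T), the same computation with M yields
     L_t - L_(t+1) >= (rho lam - M rho^2 U^2 / 2) |g|^2
                      + (rho - M U rho^2 / 2) Q,
     provided 1 <= M U and rho M U <= 2.
   The right-hand side of the latter is at least eta times that of the former,
   where eta enters only through the first argument of its minimum.  The
   inequalities delta lam <= 1 <= M U are forced by the trajectory: otherwise
   the diagonal of C_t would decay to 0 or blow up geometrically. *)

(** * Lebesgue measure on tuples *)

Section lebesgue_affine.
Context {R : realType}.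

Lemma measurable_affine (a c : R) :
  measurable_fun setT (fun x : measurableTypeR R => a + c * x : measurableTypeR R).
Proof.
apply: continuous_measurable_fun => x.
by apply: cvgD; [exact: cvg_cst|apply: cvgM; [exact: cvg_cst|exact: cvg_id]].
Qed.

(** The measure sending [A] to [c] times the length of [phi^-1 A] gives half-open intervals their
    own length, so it is Lebesgue measure by uniqueness; what remains is the change of variables for
    a pushforward. *)
Lemma ge0_integral_affine (a c : R) (f : measurableTypeR R -> \bar R) :
  0 < c -> measurable_fun setT f -> (forall x, (0 <= f x)%E) ->
  (\int[@lebesgue_measure R]_x f x
   = c%:E * \int[@lebesgue_measure R]_x f (a + c * x)%R)%E.
Proof.
move=> c0 mf f0.
pose mphi := measurable_affine a c.
pose phi (x : measurableTypeR R) : measurableTypeR R := a + c * x.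
pose nu : {measure set (measurableTypeR R) -> \bar R} :=
  mscale (NngNum (ltW c0)) (pushforward (@lebesgue_measure R) phi).
rewrite (eq_measure_integral (nu mphi)) => [|A mA _]; last first.
  apply: lebesgue_measure_unique => // _ [[u v] _ <-] /=.
  rewrite /mscale/= /pushforward/=.
  have -> : (fun x => a + c * x) @^-1` `]u, v]%classic =
      `](u - a) / c, (v - a) / c]%classic.
    apply/seteqP; split=> x /=; rewrite !in_itv/= ltr_pdivrMr// ler_pdivlMr//;
      by move=> /andP[? ?]; apply/andP; split; lra.
  rewrite !lebesgue_measure_itv/= !lte_fin ltr_pM2r ?invr_gt0//.
  have -> : (u - a < v - a) = (u < v) by apply/idP/idP; lra.
  case: ifPn => _; last by rewrite mule0.
  by rewrite -!EFinB -EFinM; congr EFin; field; exact: lt0r_neq0.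
rewrite ge0_integral_mscale//= ge0_integral_pushforward//.
Qed.

End lebesgue_affine.

Section lebesgue_tuple_integral.
Context {R : realType}.

(** The measure in dimension [d.+1] is by definition a pushforward of a product, so Tonelli's
    theorem applies. *)
Lemma ge0_integral_lebesgue_tupleS (d : nat) (f : d.+1.-tuple R -> \bar R) :
  measurable_fun setT f -> (forall t, (0 <= f t)%E) ->
  (\int[lebesgue_tuple d.+1]_t f t
   = \int[@lebesgue_measure R]_x \int[lebesgue_tuple d]_t
       f [tuple of x :: t])%E.
Proof.
move=> mf f0.
rewrite [LHS](@ge0_integral_pushforward _ _ _ _ _ _ measurable_cons_pair)//.
rewrite preimage_setT fubini_tonelli1//.
  by apply: measurableT_comp => //; exact: measurable_cons_pair.
by move=> *; exact: f0.
Qed.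

Definition affine_tuple d (m : 'I_d -> R) (C : 'I_d -> 'I_d -> R)
    (t : d.-tuple R) : d.-tuple R :=
  [tuple m i + \sum_(j < d) C i j * tnth t j | i < d].

Lemma measurable_affine_tuple d m C : measurable_fun setT (@affine_tuple d m C).
Proof.
apply/measurable_fun_tnthP => i.
rewrite (_ : _ \o _ = fun t : d.-tuple R =>
    m i + \sum_(j < d) C i j * tnth t j); last first.
  by apply/funext => t /=; rewrite tnth_mktuple.
apply: measurable_funD; first exact: measurable_cst.
apply: measurable_sum => j; apply: measurable_funM; first exact: measurable_cst.
exact: measurable_tnth.
Qed.

(** Triangularity allows an induction on [d]: the first coordinate is substituted on its own, and
    once it is frozen the others undergo a triangular affine map of size one less. The product of
    the diagonal is the Jacobian. *)
Lemma ge0_integral_affine_tuple d m C (f : d.-tuple R -> \bar R) :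
  (forall i j : 'I_d, (i < j)%N -> C i j = 0) -> (forall i, 0 < C i i) ->
  measurable_fun setT f -> (forall t, (0 <= f t)%E) ->
  (\int[lebesgue_tuple d]_t f t =
   (\prod_(i < d) C i i)%:E *
   \int[lebesgue_tuple d]_t f (affine_tuple m C t))%E.
Proof.
elim: d m C f => [|d IH] m C f trigC C0 mf f0.
  rewrite big_ord0 mul1e; apply: eq_integral => t _; congr f.
  by rewrite tuple0 [RHS]tuple0.
rewrite !ge0_integral_lebesgue_tupleS//; last first.
  by apply: measurableT_comp => //; exact: measurable_affine_tuple.
have mcons (x : R) :
    measurable_fun setT (fun t : d.-tuple R => f [tuple of x :: t]).
  apply: (measurableT_comp mf).
  apply: (measurable_cons (f := fun=> x) (g := id)) => //.
have mc : measurable_fun setT (fun p : measurableTypeR R * d.-tuple R =>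
    f [tuple of p.1 :: p.2]).
  by apply: (measurableT_comp mf); exact: measurable_cons_pair.
have mint := measurable_fun_fubini_tonelli_F (m2 := lebesgue_tuple d)
  _ mc (fun=> f0 _).
rewrite big_ord_recl EFinM -muleA.
rewrite (@ge0_integral_affine _ (m ord0) (C ord0 ord0))//; last first.
  by move=> x; exact: integral_ge0.
congr (_ * _)%E.
rewrite -ge0_integralZl//=; last 3 first.
- apply: (measurable_fun_fubini_tonelli_F (m2 := lebesgue_tuple d)
    (fun p => f (affine_tuple m C [tuple of p.1 :: p.2]))) => //.
  apply: (measurableT_comp mf); apply: measurableT_comp.
    exact: measurable_affine_tuple.
  exact: measurable_cons_pair.
- by move=> x _; exact: integral_ge0.
- by rewrite lee_fin prodr_ge0// => i _; exact: ltW.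
apply: eq_integral => x _.
(* With the first input coordinate fixed at [x], the rest of the first column of [C] only shifts the
   translation. *)
rewrite (IH (fun i => m (lift ord0 i) + C (lift ord0 i) ord0 * x)
  (fun i j => C (lift ord0 i) (lift ord0 j)))//; last first.
  by move=> i j ij; rewrite trigC.
congr (_ * _)%E; apply: eq_integral => t _; congr f.
apply: eq_from_tnth => i; rewrite tnth_mktuple big_ord_recl.
have [->|[j ->]] : i = ord0 \/ exists j, i = lift ord0 j.
  by case: (unliftP ord0 i) => [j ->|->]; [right; exists j|left].
  rewrite !tnth0 big1 ?addr0// => j _.
  by rewrite trigC ?mul0r.
rewrite !tnthS tnth_mktuple tnth0 addrA; congr (_ + _).
by apply: eq_bigr => k _; rewrite tnthS.
Qed.

End lebesgue_tuple_integral.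

(** * Measurability of continuous functions of a column vector *)

Section measurable_cV_of_tuple.
Context {R : realType} {d : nat}.

(** The sigma-algebra on tuples is generated by the coordinates. An open set is the countable union
    of the balls it contains that have a rational centre and a radius [1 / (k + 1)], and each ball,
    being a box, is a finite intersection of coordinate conditions. *)
Lemma measurable_preimage_open_cV (U : set 'cV[R]_d) :
  open U -> measurable (@cV_of_tuple R d @^-1` U).
Proof.
move=> oU.
pose r (p : 'cV[rat]_d * nat) : R := p.2.+1%:R^-1.
pose B (p : 'cV[rat]_d * nat) := ball (map_mx ratr p.1 : 'cV[R]_d) (r p).
have -> : @cV_of_tuple R d @^-1` U =
    \bigcup_(p in [set p | B p `<=` U]) (@cV_of_tuple R d @^-1` B p).
  apply/seteqP; split=> [t /= Ut|t [p /= BU] Bt]; last exact: BU.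
  have /nbhs_ballP[e /= e0 eU] : nbhs (cV_of_tuple t) U.
    by move: oU; rewrite openE; exact.
  have [n ne] : exists n : nat, n.+1%:R^-1 < e / 2.
    have e20 : 0 < e / 2 by lra.
    have [n _ /(_ n (leqnn _))] := near_infty_natSinv_lt (PosNum e20).
    by move=> ?; exists n.
  have n0 : 0 < n.+1%:R^-1 :> R by rewrite invr_gt0.
  have /choice[q qt] (i : 'I_d) : exists q : rat,
      ratr q \in `](tnth t i - n.+1%:R^-1), (tnth t i + n.+1%:R^-1)[.
    by apply: rat_in_itvoo; rewrite ltrBlDr -addrA ltrDl addr_gt0.
  exists (\col_i q i, n) => /=; rewrite ?/B /r/=;
    move: (n.+1%:R^-1) ne qt n0 => a ne qt a0.
    move=> y [_ By]; apply: eU; split=> // i j; move: (By i j) (qt i).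
    rewrite !mxE /ball/= in_itv/= ltr_distlC /r/= => /andP[h1 h2] /andP[h3 h4].
    by rewrite ltr_distlC; apply/andP; split; lra.
  split=> // i j; move: (qt i); rewrite in_itv/= !mxE /ball/= /r/=.
  by move=> /andP[? ?]; rewrite ltr_distlC; apply/andP; split; lra.
rewrite bigcup_mkcond; apply: countable_bigcupT_measurable => [|p].
  exact: countableP.
case: ifPn => // _.
have -> : @cV_of_tuple R d @^-1` B p = \bigcap_(i in [set: 'I_d])
    ((fun t : d.-tuple R => tnth t i) @^-1` ball (ratr (p.1 i ord0) : R) (r p)).
  apply/seteqP; split=> [t [_ Bt] i _|t Bt] /=.
    by have := Bt i ord0; rewrite !mxE.
  split=> [|i j]; first by rewrite invr_gt0.
  by have := Bt i I; rewrite !mxE (ord1 j).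
apply: fin_bigcap_measurable => [|i _]; first exact: finite_finset.
rewrite -[X in measurable X]setTI; apply: measurable_tnth => //.
by apply: open_measurable; apply: ball_open.
Qed.

Lemma continuous_measurable_cV (f : 'cV[R]_d -> R) : continuous f ->
  measurable_fun setT (fun t : d.-tuple R => f (cV_of_tuple t)).
Proof.
move=> /continuousP cf; apply: (measurability _ (RGenOpens.measurableE R)).
move=> _ [_ [a [b ->] <-]]; rewrite setTI.
apply: (measurable_preimage_open_cV (U := f @^-1` `]a, b[%classic)).
exact/cf/interval_open.
Qed.

End measurable_cV_of_tuple.

(** * Gaussian expectations *)

Section standard_gaussian.
Context {R : realType} {d : nat}.
Implicit Types (f g : 'cV[R]_d -> R) (m z : 'cV[R]_d) (C : 'M[R]_d).

(** The positive and the negative part are transformed separately; multiplication by [\det C], which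
    is nonnegative, respects this splitting. *)
Lemma Rintegral_affine_tuple m C (f : d.-tuple R -> R) : Omega (m, C) ->
  measurable_fun setT f ->
  \int[lebesgue_tuple d]_t f t =
  \int[lebesgue_tuple d]_t
    (\det C * f (affine_tuple (fun i => m i 0) (fun i j => C i j) t)).
Proof.
move=> [/= trigC C0] mf; rewrite (det_trig trigC).
move/is_trig_mxP in trigC.
have p0 : 0 <= \prod_(i < d) C i i by apply: prodr_ge0 => i _; exact: ltW.
pose a := affine_tuple (fun i => m i 0) (fun i j => C i j).
have mE : measurable_fun setT (EFin \o f) by exact/measurable_EFinP.
have mEa : measurable_fun setT (EFin \o f \o a).
  by apply: measurableT_comp => //; exact: measurable_affine_tuple.
rewrite /Rintegral; congr fine.
under [RHS]eq_integral do rewrite EFinM.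
rewrite integralE [RHS]integralE.
rewrite (ge0_funeposM (EFin \o f \o a))// (ge0_funenegM (EFin \o f \o a))//.
rewrite !ge0_integralZl//=; last 2 first.
  exact: measurable_funeneg.
  exact: measurable_funepos.
congr (_ - _)%E; rewrite (ge0_integral_affine_tuple (fun i => m i 0) trigC).
- by congr (_ * _)%E; apply: eq_integral => t _; rewrite /= !(funeposE, funenegE).
- exact: C0.
- exact: measurable_funepos.
- by move=> t; exact: funepos_ge0.
- by congr (_ * _)%E; apply: eq_integral => t _; rewrite /= !(funeposE, funenegE).
- exact: C0.
- exact: measurable_funeneg.
- by move=> t; exact: funeneg_ge0.
Qed.

Lemma cV_of_affine_tuple m C t :
  cV_of_tuple (affine_tuple (fun i => m i 0) (fun i j => C i j) t) =
  m + C *m cV_of_tuple t.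
Proof.
apply/matrixP => i j; rewrite (ord1 j) !mxE tnth_mktuple; congr (_ + _).
by apply: eq_bigr => k _; rewrite mxE.
Qed.

Lemma Omega_det_gt0 m C : Omega (m, C) -> 0 < \det C.
Proof. by move=> [/= /det_trig -> C0]; apply: prodr_gt0. Qed.

(** The factor [\det C] cancels against the normalization, and [C^T (C C^T)^-1 C] is the
    identity. *)
Lemma gauss_pdf_affine m C z : Omega (m, C) ->
  \det C * gauss_pdf m (C *m C^T) (m + C *m z) = gauss_pdf 0 1%:M z.
Proof.
move=> /Omega_det_gt0 C0.
have uC : C \in unitmx by rewrite unitmxE unitfE gt_eqF.
have uV : C *m C^T \in unitmx by rewrite unitmx_mul uC unitmx_tr.
rewrite /gauss_pdf addrC addKr subr0 det1 mulr1 invmx1 mulmx1.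
rewrite det_mulmx det_tr -expr2 sqrtrM ?exprn_ge0 ?mulr_ge0 ?pi_ge0//.
rewrite sqrtr_sqr gtr0_norm// invfM mulrA mulrCA divff ?gt_eqF// mulr1.
congr (_ * expR (_ * _ 0 0)).
have VC : invmx (C *m C^T) *m C *m C^T = 1%:M by rewrite -mulmxA mulVmx.
by rewrite trmx_mul !mulmxA -[_ *m C]mulmxA -(mulmxA _ C^T) (mulmx1C VC) mulmx1.
Qed.

Lemma gauss_pdf_gt0 m C z : Omega (m, C) -> 0 < gauss_pdf m (C *m C^T) z.
Proof.
move=> /Omega_det_gt0 C0; apply: mulr_gt0; last exact: expR_gt0.
rewrite invr_gt0 sqrtr_gt0 mulr_gt0 ?exprn_gt0 ?mulr_gt0 ?pi_gt0//.
by rewrite det_mulmx det_tr mulr_gt0.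
Qed.

Definition gauss_weight (t : d.-tuple R) : R :=
  \prod_(i < d) normal_pdf 0 1 (tnth t i).

Lemma gauss_pdf_std (t : d.-tuple R) :
  gauss_pdf 0 1%:M (cV_of_tuple t) = gauss_weight t.
Proof.
rewrite /gauss_weight /gauss_pdf subr0 det1 mulr1 invmx1 mulmx1.
under eq_bigr do rewrite normal_pdfE ?oner_eq0//=.
rewrite big_split/= -expR_sum prodr_const card_ord; congr (_ * expR _).
  rewrite /normal_peak expr1n mul1r -[pi *+ 2]mulr_natl exprVn; congr _^-1.
  have pi2 : 0 <= 2 * pi :> R by rewrite mulr_ge0 ?pi_ge0.
  by rewrite -{1}(sqr_sqrtr pi2) exprAC sqrtr_sqr ger0_norm// exprn_ge0 ?sqrtr_ge0.
rewrite mxE mulr_sumr; apply: eq_bigr => i _; rewrite !mxE subr0 expr1n.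
by field.
Qed.

Lemma gauss_weight_ge0 t : 0 <= gauss_weight t.
Proof. by apply: prodr_ge0 => i _; exact: normal_pdf_ge0. Qed.

Lemma measurable_gauss_weight : measurable_fun setT gauss_weight.
Proof.
apply: measurable_prod => i _; apply: measurableT_comp.
  exact: measurable_normal_pdf.
exact: measurable_tnth.
Qed.

Definition std_E f : R := gauss_E 0 1%:M f.

Lemma std_EE f :
  std_E f = \int[lebesgue_tuple d]_t (f (cV_of_tuple t) * gauss_weight t).
Proof.
by rewrite /std_E /gauss_E; apply: eq_Rintegral => t _; rewrite gauss_pdf_std.
Qed.

Definition cV_measurable f :=
  measurable_fun setT (fun t : d.-tuple R => f (cV_of_tuple t)).

Lemma cV_measurable_affine m C f : cV_measurable f ->
  cV_measurable (fun z => f (m + C *m z)).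
Proof.
move=> mf; rewrite /cV_measurable.
rewrite [X in measurable_fun _ X](_ : _ = (fun t => f (cV_of_tuple t)) \o
  affine_tuple (fun i => m i 0) (fun i j => C i j)).
  by apply: measurableT_comp => //; exact: measurable_affine_tuple.
by apply/funext => t /=; rewrite cV_of_affine_tuple.
Qed.

(** Inverting the substitution exhibits this density as a multiple of the standard one composed with
    an affine map. *)
Lemma measurable_gauss_pdf m C : Omega (m, C) ->
  cV_measurable (gauss_pdf m (C *m C^T)).
Proof.
move=> /[dup] oC /Omega_det_gt0 C0.
have uC : C \in unitmx by rewrite unitmxE unitfE gt_eqF.
have mw : cV_measurable (gauss_pdf 0 1%:M).
  rewrite /cV_measurable; under eq_fun do rewrite gauss_pdf_std.
  exact: measurable_gauss_weight.
rewrite (_ : gauss_pdf _ _ = fun z =>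
    (\det C)^-1 * gauss_pdf 0 1%:M (- (invmx C *m m) + invmx C *m z)).
  apply: measurable_funM; first exact: measurable_cst.
  exact: (cV_measurable_affine _ _ mw).
apply/funext => z; rewrite -(gauss_pdf_affine _ oC) mulKf ?gt_eqF//.
by rewrite mulmxDr mulmxN !mulKVmx// addrA subrr add0r.
Qed.

Lemma gauss_E_affine m C f : Omega (m, C) -> cV_measurable f ->
  gauss_E m (C *m C^T) f = std_E (fun z => f (m + C *m z)).
Proof.
move=> oC mf; rewrite /std_E /gauss_E (Rintegral_affine_tuple oC); last first.
  by apply: measurable_funM => //; exact: measurable_gauss_pdf.
apply: eq_Rintegral => t _; rewrite cV_of_affine_tuple mulrCA.
by rewrite gauss_pdf_affine.
Qed.

End standard_gaussian.

(** * Functions of at most exponential growth *)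

Section exponential_growth.
Context {R : realType} {d : nat}.
Implicit Types (f g : 'cV[R]_d -> R) (m z : 'cV[R]_d) (C : 'M[R]_d).

(** The sum norm is chosen because its exponential is a product over the coordinates, so that
    Gaussian integrability reduces to dimension one. *)
Definition norm1 z : R := \sum_i `|z i 0|.

Lemma norm1_ge0 z : 0 <= norm1 z.
Proof. exact: sumr_ge0. Qed.

Lemma le_norm1 z i : `|z i 0| <= norm1 z.
Proof. by rewrite /norm1 (bigD1 i)//= lerDl sumr_ge0. Qed.

Lemma norm1D m z : norm1 (m + z) <= norm1 m + norm1 z.
Proof. by rewrite -big_split ler_sum// => i _; rewrite mxE ler_normD. Qed.

Lemma norm1_mulmx C z : norm1 (C *m z) <= (\sum_i \sum_j `|C i j|) * norm1 z.
Proof.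
rewrite mulr_suml ler_sum// => i _; rewrite mxE mulr_suml.
apply: (le_trans (ler_norm_sum _ _ _)); apply: ler_sum => j _.
by rewrite normrM ler_wpM2l// le_norm1.
Qed.

Definition exp_growth_by (K a : R) f :=
  forall z, `|f z| <= K * expR (a * norm1 z).

(** This class contains every integrand for which linearity or monotonicity of the expectation is
    invoked; it is closed under sums, products and affine substitutions. *)
Definition exp_growth f := cV_measurable f /\
  exists K a, [/\ 0 <= K, 0 <= a & exp_growth_by K a f].

Lemma exp_growth_cst (c : R) : exp_growth (fun=> c).
Proof.
split; first exact: measurable_cst.
exists `|c|, 0; split=> // z; by rewrite mul0r expR0 mulr1.
Qed.

Lemma exp_growthD f g : exp_growth f -> exp_growth g ->
  exp_growth (fun z => f z + g z).
Proof.
move=> [mf [K [a [K0 a0 fK]]]] [mg [L [b [L0 b0 gL]]]]; split.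
  exact: measurable_funD.
exists (K + L), (a + b); split; rewrite ?addr_ge0// => z.
have n0 := norm1_ge0 z.
apply: (le_trans (ler_normD _ _)); rewrite mulrDl lerD//.
  apply: le_trans (fK z) _; rewrite ler_wpM2l// ler_expR ler_wpM2r//; lra.
apply: le_trans (gL z) _; rewrite ler_wpM2l// ler_expR ler_wpM2r//; lra.
Qed.

Lemma exp_growthM f g : exp_growth f -> exp_growth g ->
  exp_growth (fun z => f z * g z).
Proof.
move=> [mf [K [a [K0 a0 fK]]]] [mg [L [b [L0 b0 gL]]]]; split.
  exact: measurable_funM.
exists (K * L), (a + b); split; rewrite ?addr_ge0 ?mulr_ge0// => z.
by rewrite normrM mulrDl expRD mulrACA ler_pM.
Qed.

Lemma exp_growthZ (c : R) f : exp_growth f -> exp_growth (fun z => c * f z).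
Proof. by move=> gf; apply: exp_growthM => //; exact: exp_growth_cst. Qed.

Lemma exp_growthB f g : exp_growth f -> exp_growth g ->
  exp_growth (fun z => f z - g z).
Proof.
move=> gf /(exp_growthZ (-1)) gg; have := exp_growthD gf gg.
by under eq_fun do rewrite mulN1r.
Qed.

Lemma exp_growth_sum (I : Type) (r : seq I) (P : pred I)
    (F : I -> 'cV[R]_d -> R) : (forall i, exp_growth (F i)) ->
  exp_growth (fun z => \sum_(i <- r | P i) F i z).
Proof.
move=> gF; elim: r => [|i r IH].
  by under eq_fun do rewrite big_nil; exact: exp_growth_cst.
by under eq_fun do rewrite big_cons; case: (P i) => //; exact: exp_growthD.
Qed.

Lemma exp_growth_coord (i : 'I_d) : exp_growth (fun z => z i 0).
Proof.
split.
  rewrite /cV_measurable; under eq_fun do rewrite mxE; exact: measurable_tnth.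
exists 1, 1; split=> // z; rewrite !mul1r.
by apply: le_trans (le_norm1 _ _) _; have := expR_ge1Dx (norm1 z); lra.
Qed.

(** Since [1 + x <= expR x], the square of the norm is at most [expR (2 * norm1 z)]. *)
Lemma exp_growth_quad f (A B : R) : cV_measurable f -> 0 <= A -> 0 <= B ->
  (forall z, `|f z| <= A + B * norm1 z ^+ 2) -> exp_growth f.
Proof.
move=> mf A0 B0 fAB; split=> //.
exists (A + B), 2; split; rewrite ?addr_ge0// => z.
apply: le_trans (fAB z) _; have n0 := norm1_ge0 z.
rewrite mulrDl lerD//.
  by rewrite ler_peMr// -expR0 ler_expR mulr_ge0.
rewrite ler_wpM2l// expRM_natl lerXn2r ?nnegrE ?expR_ge0//.
by have := expR_ge1Dx (norm1 z); lra.
Qed.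

Lemma exp_growth_by_affine (K a : R) f m C : 0 <= K -> 0 <= a ->
  exp_growth_by K a f ->
  exp_growth_by (K * expR (a * norm1 m)) (a * \sum_i \sum_j `|C i j|)
    (fun z => f (m + C *m z)).
Proof.
move=> K0 a0 fK z; apply: le_trans (fK _) _.
rewrite -mulrA -expRD ler_wpM2l// ler_expR -mulrA -mulrDr ler_wpM2l//.
by apply: le_trans (norm1D _ _) _; rewrite lerD2l norm1_mulmx.
Qed.

Lemma exp_growth_affine f m C : exp_growth f ->
  exp_growth (fun z => f (m + C *m z)).
Proof.
move=> [mf [K [a [K0 a0 fK]]]]; split; first exact: cV_measurable_affine.
exists (K * expR (a * norm1 m)), (a * \sum_i \sum_j `|C i j|).
split; first by rewrite mulr_ge0 ?expR_ge0.
  by rewrite mulr_ge0 ?sumr_ge0// => i _; exact: sumr_ge0.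
exact: exp_growth_by_affine.
Qed.

End exponential_growth.

(** * Gaussian integrability of exponentials *)

Section gaussian_integrability.
Context {R : realType}.

Lemma ge0_integral_tuple_prod (d : nat) (h : measurableTypeR R -> R) (I : R) :
  measurable_fun setT h -> (forall x, 0 <= h x) ->
  (\int[@lebesgue_measure R]_x (h x)%:E = I%:E)%E ->
  (\int[lebesgue_tuple d]_t (\prod_(i < d) h (tnth t i))%:E = (I ^+ d)%:E)%E.
Proof.
move=> mh h0 hI; have mprod n : measurable_fun setT
    (fun t : n.-tuple R => (\prod_(i < n) h (tnth t i))%:E).
  apply/measurable_EFinP; apply: measurable_prod => i _.
  by apply: measurableT_comp => //; exact: measurable_tnth.
elim: d => [|d IH].
  rewrite [LHS]integral_dirac//; last exact: (mprod 0).
  by rewrite /dirac /= indicE in_setT mul1e big_ord0 expr0.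
rewrite ge0_integral_lebesgue_tupleS//; last first.
  by move=> t; rewrite lee_fin prodr_ge0.
under eq_integral => x _.
  under eq_integral => t _.
    rewrite big_ord_recl tnth0; under eq_bigr do rewrite tnthS.
    rewrite EFinM; over.
  rewrite ge0_integralZl ?lee_fin//; last by move=> t _; rewrite lee_fin prodr_ge0.
  rewrite IH muleC; over.
- exact: mprod.
rewrite (ge0_integralZl _ measurableT (f := EFin \o h)).
- by rewrite hI -EFinM exprSr.
- exact/measurable_EFinP.
- by move=> x _; rewrite lee_fin.
- by rewrite lee_fin exprn_ge0// -lee_fin -hI integral_ge0// => x _; rewrite lee_fin.
Qed.

(** Expanding the square of [a - |x| / 2] gives [a |x| - x^2 / 2 <= a^2 - x^2 / 4], so the integrand
    is at most [K] times the centred normal density of variance 2. *)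
Lemma integral_expR_normal (a : R) : exists I : R,
  (\int[@lebesgue_measure R]_x (expR (a * `|x|) * normal_pdf 0 1 x)%:E
   = I%:E)%E.
Proof.
have s20 : Num.sqrt 2 != 0 :> R by rewrite gt_eqF// sqrtr_gt0.
pose K := expR (a ^+ 2) * normal_peak 1 / normal_peak (Num.sqrt 2) : R.
have m1 : measurable_fun setT
    (fun x : measurableTypeR R => expR (a * `|x|) * normal_pdf 0 1 x).
  apply: measurable_funM; last exact: measurable_normal_pdf.
  apply: (measurableT_comp (f := expR)); first exact: measurable_expR.
  by apply: measurable_funM; [exact: measurable_cst|exact: normr_measurable].
have ig : (@lebesgue_measure R).-integrable setT
    (fun x => (K%:E * (normal_pdf 0 (Num.sqrt 2) x)%:E)%E).
  by apply: integrableZl => //; exact: integrable_normal_pdf.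
have : (@lebesgue_measure R).-integrable setT
    (fun x => (expR (a * `|x|) * normal_pdf 0 1 x)%:E).
  apply: le_integrable ig => //; first exact/measurable_EFinP.
  move=> x _; rewrite -EFinM !abse_EFin lee_fin.
  have n20 : 0 < normal_peak (Num.sqrt 2) :> R by exact: normal_peak_gt0.
  have n1 : 0 <= normal_peak 1 :> R by exact: normal_peak_ge0.
  have K0 : 0 <= K.
    by apply: mulr_ge0; rewrite ?invr_ge0 ?(ltW n20)// mulr_ge0 ?expR_ge0.
  rewrite [leLHS]ger0_norm ?mulr_ge0 ?expR_ge0 ?normal_pdf_ge0//.
  rewrite [leRHS]ger0_norm; last by apply: mulr_ge0 => //; exact: normal_pdf_ge0.
  rewrite !normal_pdfE ?oner_eq0//= /K /normal_fun.
  rewrite mulrCA -expRD [leRHS](_ : _ = normal_peak 1 *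
    expR (a ^+ 2 + - (x - 0) ^+ 2 / (Num.sqrt 2 ^+ 2 *+ 2))); last first.
    by rewrite expRD; field; rewrite gt_eqF.
  rewrite ler_wpM2l// ler_expR subr0 expr1n sqr_sqrtr//.
  rewrite -(real_normK (num_real x)).
  by have := sqr_ge0 (a - `|x| / 2); lra.
move=> /integrable_fin_num; move=> /(_ measurableT)/fineK <-; eexists; reflexivity.
Qed.

End gaussian_integrability.

(** * Linearity, monotonicity and dominated convergence of the expectation *)

Section standard_gaussian_expectation.
Context {R : realType} {d : nat}.
Implicit Types (f g : 'cV[R]_d -> R) (m z : 'cV[R]_d) (C : 'M[R]_d).

Let mu := @lebesgue_tuple R d.

Lemma integrable_exp_weight (a : R) :
  mu.-integrable setT
    (fun t => (expR (a * norm1 (cV_of_tuple t)) * gauss_weight t)%:E).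
Proof.
have [I hI] := integral_expR_normal a.
pose h (x : measurableTypeR R) := expR (a * `|x|) * normal_pdf 0 1 x.
have h0 x : 0 <= h x by rewrite mulr_ge0 ?expR_ge0 ?normal_pdf_ge0.
have mh : measurable_fun setT h.
  apply: measurable_funM; last exact: measurable_normal_pdf.
  apply: (measurableT_comp (f := expR)); first exact: measurable_expR.
  by apply: measurable_funM; [exact: measurable_cst|exact: normr_measurable].
have hE : (fun t : d.-tuple R =>
      (expR (a * norm1 (cV_of_tuple t)) * gauss_weight t)%:E) =
    (fun t => (\prod_(i < d) h (tnth t i))%:E).
  apply/funext => t; rewrite /norm1 mulr_sumr expR_sum -big_split/=.
  by congr EFin; apply: eq_bigr => i _; rewrite mxE.
rewrite hE; apply/integrableP; split.
  apply/measurable_EFinP; apply: measurable_prod => i _.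
  by apply: measurableT_comp => //; exact: measurable_tnth.
under eq_integral do rewrite abse_EFin ger0_norm ?prodr_ge0//.
by rewrite (ge0_integral_tuple_prod _ mh h0 hI) ltry.
Qed.

Lemma exp_growth_integrable f : exp_growth f ->
  mu.-integrable setT (fun t => (f (cV_of_tuple t) * gauss_weight t)%:E).
Proof.
move=> [mf [K [a [K0 a0 fK]]]].
have iK : mu.-integrable setT (fun t =>
    (K%:E * (expR (a * norm1 (cV_of_tuple t)) * gauss_weight t)%:E)%E).
  by apply: integrableZl => //; exact: integrable_exp_weight.
apply: le_integrable iK => //.
  by apply/measurable_EFinP; apply: measurable_funM => //;
    exact: measurable_gauss_weight.
move=> t _; rewrite -EFinM !abse_EFin lee_fin mulrA [leLHS]normrM [leRHS]normrM.
by rewrite ler_wpM2r// (le_trans (fK _))// ler_norm.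
Qed.

Lemma std_E_cst (c : R) : std_E (fun _ : 'cV[R]_d => c) = c.
Proof.
have w1 : (\int[mu]_t (gauss_weight t)%:E = 1)%E.
  rewrite (@ge0_integral_tuple_prod _ d (normal_pdf 0 1) 1) ?expr1n//.
  - exact: measurable_normal_pdf.
  - exact: normal_pdf_ge0.
  - exact: integral_normal_pdf.
rewrite std_EE RintegralZl//; first by rewrite /Rintegral w1 mulr1.
have := exp_growth_integrable (exp_growth_cst 1).
by under eq_fun do rewrite mul1r.
Qed.

Lemma std_ED f g : exp_growth f -> exp_growth g ->
  std_E (fun z => f z + g z) = std_E f + std_E g.
Proof.
move=> gf gg; rewrite !std_EE; under eq_Rintegral do rewrite mulrDl.
by rewrite RintegralD//; exact: exp_growth_integrable.
Qed.

Lemma std_EZ (c : R) f : exp_growth f ->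
  std_E (fun z => c * f z) = c * std_E f.
Proof.
move=> gf; rewrite !std_EE; under eq_Rintegral do rewrite -mulrA.
by rewrite RintegralZl//; exact: exp_growth_integrable.
Qed.

Lemma std_EB f g : exp_growth f -> exp_growth g ->
  std_E (fun z => f z - g z) = std_E f - std_E g.
Proof.
move=> gf gg; under [in LHS]eq_fun do rewrite -mulN1r.
by rewrite std_ED// ?std_EZ ?mulN1r//; exact: exp_growthZ.
Qed.

Lemma std_E_sum (I : Type) (r : seq I) (F : I -> 'cV[R]_d -> R) :
  (forall i, exp_growth (F i)) ->
  std_E (fun z => \sum_(i <- r) F i z) = \sum_(i <- r) std_E (F i).
Proof.
move=> gF; elim: r => [|i r IH].
  by under [in LHS]eq_fun do rewrite big_nil; rewrite std_E_cst big_nil.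
under [in LHS]eq_fun do rewrite big_cons.
by rewrite std_ED ?IH ?big_cons//; exact: exp_growth_sum.
Qed.

Lemma le_std_E f g : exp_growth f -> exp_growth g ->
  (forall z, f z <= g z) -> std_E f <= std_E g.
Proof.
move=> gf gg fg; rewrite !std_EE; apply: le_Rintegral => //.
- exact: exp_growth_integrable.
- exact: exp_growth_integrable.
- by move=> t _; rewrite ler_wpM2r ?gauss_weight_ge0.
Qed.

(** Dominated convergence, with the envelope [K * expR (a * norm1 z)] common to all [n]. *)
Lemma cvg_std_E (K a : R) (f_ : ('cV[R]_d -> R)^nat) f : 0 <= K -> 0 <= a ->
  (forall n, cV_measurable (f_ n)) -> cV_measurable f ->
  (forall n, exp_growth_by K a (f_ n)) ->
  (forall z, f_ ^~ z @ \oo --> f z) ->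
  (fun n => std_E (f_ n)) @ \oo --> std_E f.
Proof.
move=> K0 a0 mf_ mf fK ff.
pose F_ n t : \bar R := (f_ n (cV_of_tuple t) * gauss_weight t)%:E.
pose F t : \bar R := (f (cV_of_tuple t) * gauss_weight t)%:E.
pose G (t : d.-tuple R) : \bar R :=
  (K%:E * (expR (a * norm1 (cV_of_tuple t)) * gauss_weight t)%:E)%E.
have mw := @measurable_gauss_weight R d.
have [] := @dominated_convergence _ _ _ mu setT measurableT F_ F G.
- by move=> n; apply/measurable_EFinP; apply: measurable_funM; [exact: mf_|].
- by apply/measurable_EFinP; apply: measurable_funM.
- apply: aeW => t _; apply/cvg_EFin; first exact: nearW.
  by apply: cvgM; [exact: ff|exact: cvg_cst].
- by apply: integrableZl => //; exact: integrable_exp_weight.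
- apply: aeW => t n _; rewrite /F_ /G -EFinM abse_EFin lee_fin mulrA normrM.
  rewrite (ger0_norm (gauss_weight_ge0 _)) ler_wpM2r ?gauss_weight_ge0//.
  exact: fK.
move=> iF _; rewrite std_EE /Rintegral.
under [in X in _ -> X]eq_fun do rewrite std_EE /Rintegral.
move=> h; apply: fine_cvg; rewrite fineK//.
exact: integrable_fin_num.
Qed.

End standard_gaussian_expectation.

(** Dominated convergence concerns sequences, hence derivatives are read along the steps
    [1 / (n + 1)]. *)
Lemma cvg_diff_quotient {R : realType} (V : normedModType R) (f : V -> R)
    (x v : V) (l : R) : is_derive x v f l ->
  (fun n : nat => (harmonic n)^-1 * (f (harmonic n *: v + x) - f x)) @ \oo --> l.
Proof.
move=> [df <-]; have := df; rewrite /derivable /derive => /cvgr_dnbhsP.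
move=> /(_ harmonic); apply; split; last exact: cvg_harmonic.
by move=> n; rewrite gt_eqF// /harmonic invr_gt0.
Qed.

(** * Stein's identity *)

Section stein.
Context {R : realType} {d : nat}.
Implicit Types (u : 'cV[R]_d -> R) (z : 'cV[R]_d) (j : 'I_d).

Let e j : 'cV[R]_d := delta_mx j 0.

Lemma Omega_id (m : 'cV[R]_d) : Omega (m, 1%:M).
Proof.
split=> [|i] /=; first exact: scalar_mx_is_trig.
by rewrite !mxE eqxx.
Qed.

(** The Cameron-Martin density ratio, from [|z - h e_j|^2 = |z|^2 - 2 h z_j + h^2]. *)
Lemma gauss_pdf_shift j (h : R) z :
  gauss_pdf (h *: e j) 1%:M z =
  expR (h * z j 0 - h ^+ 2 / 2) * gauss_pdf 0 1%:M z.
Proof.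
rewrite /gauss_pdf subr0 [RHS]mulrCA -expRD; congr (_ * expR _).
rewrite invmx1 !mulmx1 !mxE !(bigD1 (P := predT) j)//= !mxE !eqxx.
rewrite [in LHS](eq_bigr (fun i => z^T 0 i * z i 0)) => [|i ij].
  by rewrite /= !mulr1; field.
by rewrite !mxE (negbTE ij)/= mulr0 oppr0 addr0.
Qed.

(* Differentiating both sides at [h = 0] gives Stein's identity. *)
Lemma std_E_shift j (h : R) u : cV_measurable u ->
  std_E (fun z => u (h *: e j + z)) =
  std_E (fun z => u z * expR (h * z j 0 - h ^+ 2 / 2)).
Proof.
move=> mu; under eq_fun do rewrite -[X in _ + X]mul1mx.
have <- := gauss_E_affine (Omega_id (h *: e j)) mu.
rewrite trmx1 mulmx1 /std_E /gauss_E; apply: eq_Rintegral => t _.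
by rewrite gauss_pdf_shift mulrA.
Qed.

(** Serves to dominate the difference quotients of the exponential factor. For [y >= 0], multiply
    [1 - y <= expR (- y)] by [expR y]; for [y < 0], combine [1 + y <= expR y] with
    [1 <= expR (- y)]. *)
Lemma norm_expRB1 (y : R) : `|expR y - 1| <= `|y| * expR `|y|.
Proof.
have e1 := expR_ge1Dx y; have e0 := expR_gt0 y.
have [y0|y0] := leP 0 y.
  rewrite !ger0_norm//; last lra.
  have := expR_ge1Dx (- y); rewrite expRN => h.
  have : (1 - y) * expR y <= 1 by rewrite -ler_pdivlMr ?div1r.
  lra.
have e2 : expR y <= 1 by rewrite -expR0 ler_expR ltW.
rewrite (ltr0_norm y0) ler0_norm; last lra.
have y1 : 1 <= expR (- y) by rewrite -expR0 ler_expR; lra.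
have : 0 <= - y * (expR (- y) - 1) by apply: mulr_ge0; lra.
lra.
Qed.

Lemma is_derive_expR_shift (c : R) :
  is_derive (0 : R) 1 (fun x : R => expR (x * c - x ^+ 2 / 2)) c.
Proof.
pose g : R -> R := c *: id - (1 / 2) *: id ^+ 2.
have gE x : g x = x * c - x ^+ 2 / 2.
  have -> : g x = c * x - (1 / 2) * x ^+ 2 by rewrite /g !fctE.
  by field.
have dg : is_derive (0 : R) 1 g c.
  apply: is_derive_eq.
  by rewrite scaler1 /= mulr0 scale0r scaler0 subr0.
have := is_derive1_comp (is_derive_expR (g 0)) dg.
rewrite gE mul0r expr0n/= mul0r subr0 expR0 mul1r.
rewrite (_ : _ \o g = fun x => expR (x * c - x ^+ 2 / 2))//.
by apply/funext => x /=; rewrite gE.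
Qed.

(** [A n] and [B n] are the integrands of the difference quotients, at step [1 / (n + 1)], of the
    two sides of [std_E_shift]. Their expectations agree, and dominated convergence sends them to
    the two sides of the claim; the Lipschitz bound dominates [A n]. *)
Lemma stein u du j (L : R) : exp_growth u -> cV_measurable du ->
  (forall z, is_derive z (e j) u (du z)) ->
  (forall z (h : R), `|u (h *: e j + z) - u z| <= L * `|h|) ->
  std_E (fun z => u z * z j 0) = std_E du.
Proof.
move=> gu mdu dudu uL; have L0 : 0 <= L.
  by have := le_trans (normr_ge0 _) (uL 0 1); rewrite normr1 mulr1.
pose h n : R := harmonic n.
have h0 n : 0 < h n by rewrite /h /harmonic invr_gt0.
have h1 n : h n <= 1 by rewrite /h /harmonic invf_le1// ler1n.
have mshift (n : nat) : cV_measurable (fun z => u (h n *: e j + z)).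
  have := cV_measurable_affine (h n *: e j) 1%:M gu.1.
  by under eq_fun do rewrite mul1mx.
have mw (n : nat) : cV_measurable
    (fun z => expR (h n * z j 0 - h n ^+ 2 / 2)).
  apply: (measurableT_comp (f := expR)); first exact: measurable_expR.
  apply: measurable_funB; last exact: measurable_cst.
  apply: measurable_funM; first exact: measurable_cst.
  exact: (exp_growth_coord j).1.
pose A n z := (h n)^-1 * (u (h n *: e j + z) - u z).
pose B n z := u z * ((h n)^-1 * (expR (h n * z j 0 - h n ^+ 2 / 2) - 1)).
have cA : (fun n => std_E (A n)) @ \oo --> std_E du.
  apply: (@cvg_std_E _ _ L 0) => //.
  - move=> n; apply: measurable_funM; first exact: measurable_cst.
    by apply: measurable_funB; [exact: mshift|exact: gu.1].
  - move=> n z; rewrite mul0r expR0 mulr1 /A normrM gtr0_norm ?invr_gt0//.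
    by rewrite ler_pdivrMl// mulrC (le_trans (uL _ _))// gtr0_norm.
  - by move=> z; apply: cvg_diff_quotient.
have [mu [K [a [K0 a0 uK]]]] := gu.
have cB : (fun n => std_E (B n)) @ \oo --> std_E (fun z => u z * z j 0).
  (* The exponent [y] satisfies [|y| <= h (1 + |z|)], where [1 + |z| <= expR |z|]. Hence the
     quotient of [expR y - 1] by [h] is at most [expR |z| * expR (1 + |z|)], which accounts for
     [expR 1] and for the 2. *)
  apply: (@cvg_std_E _ _ (K * expR 1) (a + 2)).
  - by rewrite mulr_ge0 ?expR_ge0.
  - by rewrite addr_ge0.
  - move=> n; apply: measurable_funM; first exact: mu.
    apply: measurable_funM; first exact: measurable_cst.
    by apply: measurable_funB; [exact: mw|exact: measurable_cst].
  - by apply: measurable_funM; [exact: mu|exact: (exp_growth_coord j).1].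
  - move=> n z; rewrite /B normrM (mulrDl a) (expRD (a * _)) mulrACA ler_pM//.
    rewrite normrM gtr0_norm ?invr_gt0// ler_pdivrMl//.
    have zj := le_norm1 z j; have z0 := norm1_ge0 z; have hn := h0 n.
    have hn1 := h1 n.
    have yb : `|h n * z j 0 - h n ^+ 2 / 2| <= h n * (1 + norm1 z).
      have : `|z j 0 - h n / 2| <= 1 + norm1 z.
        apply: le_trans (ler_normB _ _) _; rewrite (gtr0_norm (divr_gt0 _ _))//.
        lra.
      rewrite -(ler_pM2l hn) -{1}(gtr0_norm hn) -normrM.
      by rewrite (_ : h n * (_ - _) = h n * z j 0 - h n ^+ 2 / 2)//; ring.
    apply: le_trans (norm_expRB1 _) _.
    rewrite -expRD (_ : 1 + 2 * norm1 z = norm1 z + (1 + norm1 z)); last by ring.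
    rewrite expRD mulrA; apply: ler_pM => //.
      apply: le_trans yb _; rewrite ler_wpM2l ?(ltW hn)//.
      exact: expR_ge1Dx.
    rewrite ler_expR (le_trans yb)//; nra.
  - move=> z; apply: cvgM; first exact: cvg_cst.
    have dexp : is_derive (0 : R) 1
        (fun x : R => expR (x * z j 0 - x ^+ 2 / 2)) (z j 0).
      exact: is_derive_expR_shift.
    have := cvg_diff_quotient dexp.
    rewrite mul0r expr0n/= mul0r subr0 expR0.
    by under eq_fun do rewrite scaler1 addr0.
have AB n : std_E (A n) = std_E (B n).
  have gw : exp_growth (fun z => expR (h n * z j 0 - h n ^+ 2 / 2)).
    split; first exact: mw.
    exists 1, 1; split=> // z; rewrite !mul1r ger0_norm ?expR_ge0// ler_expR.
    have zj := le_norm1 z j; have hn := h0 n; have hn1 := h1 n.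
    have : h n * z j 0 <= `|z j 0|.
      by apply: le_trans (ler_norm _) _; rewrite normrM gtr0_norm// ler_piMl.
    by have := sqr_ge0 (h n); lra.
  have gs : exp_growth (fun z => u (h n *: e j + z)).
    have := exp_growth_affine (h n *: e j) 1%:M gu.
    by under eq_fun do rewrite mul1mx.
  rewrite /A std_EZ ?std_EB ?std_E_shift//; last exact: exp_growthB.
  rewrite -std_EB//; last exact: exp_growthM.
  rewrite -std_EZ; last by apply: exp_growthB => //; exact: exp_growthM.
  by congr std_E; apply/funext => z; rewrite /B; ring.
move: cA; under eq_fun do rewrite AB; move=> cA.
exact: (cvg_unique _ cB cA).
Qed.

End stein.

(** * Second-order Taylor bounds *)

Section second_order_bounds.
Context {R : realType}.

(** The mean value theorem is used twice: on [f1], giving [a t <= f1 t - f1 0], then on [g], which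
    is [f] minus a quadratic chosen so that its derivative is nonnegative for [t > 0]. *)
Lemma second_order_ge (a : R) (f f1 f2 : R -> R) :
  (forall t : R, is_derive t 1 f (f1 t)) ->
  (forall t : R, is_derive t 1 f1 (f2 t)) ->
  (forall t, a <= f2 t) -> a / 2 <= f 1 - f 0 - f1 0.
Proof.
move=> df df1 af2.
have cont g g' : (forall t : R, is_derive t 1 g (g' t)) -> continuous (g : R -> R).
  move=> dg t; apply/differentiable_continuous/derivable1_diffP.
  by have [] := dg t.
have f1t (t : R) : 0 < t -> a * t <= f1 t - f1 0.
  move=> t0; have [|c _ ->] := @MVT R f1 f2 0 t t0 (fun x _ => df1 x).
    exact/continuous_subspaceT/(cont _ _ df1).
  by rewrite subr0 ler_wpM2r// ltW.
pose g : R -> R := f - (f1 0 *: id + (a / 2) *: id ^+ 2).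
have gE t : g t = f t - (f1 0 * t + a / 2 * t ^+ 2) by rewrite /g !fctE.
have dg (t : R) : is_derive t 1 g (f1 t - f1 0 - a * t).
  have dft := df t.
  have := is_deriveB dft (is_deriveD (is_deriveZ (f1 0) (is_derive_id t 1))
    (is_deriveZ (a / 2) (is_deriveX 2 (is_derive_id t 1)))).
  move=> h; apply: is_derive_eq h _.
  by rewrite !scaler1 /GRing.scale/= expr1; field.
have [|c] := @MVT R g _ 0 1 ltr01 (fun x _ => dg x).
  exact/continuous_subspaceT/(cont _ _ dg).
rewrite in_itv/= => /andP[c0 _]; have := f1t c c0.
rewrite !gE expr1n expr0n/=; lra.
Qed.

End second_order_bounds.

(** * Inner products, gradients and Hessians *)

Section multivariate.
Context {R : realType} {d : nat}.
Implicit Types (x y v w : 'cV[R]_d) (f : 'cV[R]_d -> R).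

Definition dot x y : R := \sum_i x i 0 * y i 0.

Lemma dotDr x y w : dot x (y + w) = dot x y + dot x w.
Proof. by rewrite -big_split; apply: eq_bigr => i _; rewrite mxE mulrDr. Qed.

Lemma dotZr (a : R) x y : dot x (a *: y) = a * dot x y.
Proof. by rewrite mulr_sumr; apply: eq_bigr => i _; rewrite mxE mulrCA. Qed.

Lemma dotC x y : dot x y = dot y x.
Proof. by apply: eq_bigr => i _; rewrite mulrC. Qed.

Lemma dotBr x y w : dot x (y - w) = dot x y - dot x w.
Proof. by rewrite dotDr -scaleN1r dotZr mulN1r. Qed.

Lemma dotBl x y w : dot (x - y) w = dot x w - dot y w.
Proof. by rewrite dotC dotBr dotC (dotC w). Qed.

Lemma dotZl (a : R) x y : dot (a *: x) y = a * dot x y.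
Proof. by rewrite dotC dotZr dotC. Qed.

Lemma dot_ge0 x : 0 <= dot x x.
Proof. by apply: sumr_ge0 => i _; rewrite -expr2 sqr_ge0. Qed.

Lemma mulmx_dot x y : (x^T *m y) 0 0 = dot x y.
Proof. by rewrite mxE; apply: eq_bigr => i _; rewrite mxE. Qed.

Lemma loewner_leE (A B : 'M[R]_d) : loewner_le A B <->
  forall x, dot x (A *m x) <= dot x (B *m x).
Proof.
by split=> AB x; have := AB x; rewrite -mulmxA mulmx_dot mulmxBl dotBr subr_ge0.
Qed.

Lemma dot_scalar_mx (a : R) x : dot x (a%:M *m x) = a * dot x x.
Proof. by rewrite mul_scalar_mx dotZr. Qed.

Lemma cV_sum_delta v : v = \sum_i v i 0 *: delta_mx i 0.
Proof.
apply/matrixP => i j; rewrite (ord1 j) summxE (bigD1 i)//= big1 => [|k ki].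
  by rewrite !mxE !eqxx mulr1 addr0.
by rewrite !mxE (negbTE (_ : i != k)) ?mulr0// eq_sym.
Qed.

Lemma derive_dot f x v : differentiable f x -> 'D_v f x = dot (grad f x) v.
Proof.
move=> df; rewrite deriveE// {1}(cV_sum_delta v) linear_sum.
by apply: eq_bigr => i _; rewrite linearZ mxE deriveE// mulrC.
Qed.

(** The difference quotients along the line at [t] are literally those of [f] at [x + t v] in the
    direction [v]. *)
Lemma is_derive_line f x v (t : R) : differentiable f (x + t *: v) ->
  is_derive t 1 (fun s : R => f (x + s *: v)) (dot (grad f (x + t *: v)) v).
Proof.
move=> df; have [dv dE] : is_derive (x + t *: v) v f (dot (grad f (x + t *: v)) v).
  by rewrite -derive_dot//; apply: DeriveDef => //; exact: diff_derivable.
have E : (fun h : R => h^-1 *: (((fun s : R => f (x + s *: v)) \o shift t)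
      (h *: (1 : R)) - f (x + t *: v))) =
    (fun h : R => h^-1 *: ((f \o shift (x + t *: v)) (h *: v)
      - f (x + t *: v))).
  apply/funext => h /=; congr (_ *: (f _ - _)).
  by rewrite scaler1 scalerDl addrCA.
by split; rewrite /derivable /derive E.
Qed.

Section C2_theory.
Variables (l : 'cV[R]_d -> R) (delta M : R).
Hypothesis l_C2 : C2 l.
Hypothesis M_gt0 : 0 < M.
Hypothesis delta_gt0 : 0 < delta.
Hypothesis hess_bounds : forall x,
  loewner_le delta%:M (hess l x) /\ loewner_le (hess l x) M%:M.

Lemma differentiable_gradi i x : differentiable (fun y => grad l y i 0) x.
Proof.
have [_ dg _] := l_C2.
apply: (differentiable_comp (g := fun N : 'cV[R]_d => N i 0)) => //.
exact: differentiable_coord.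
Qed.

Lemma grad_grad i x j : grad (fun y => grad l y i 0) x j 0 = hess l x i j.
Proof.
by rewrite !mxE; congr ('D_(delta_mx j 0) _ x); apply/funext => y; rewrite mxE.
Qed.

Let line_derivatives x v :
  (forall t : R, is_derive t 1 (fun s : R => l (x + s *: v))
     (dot (grad l (x + t *: v)) v)) /\
  (forall t : R, is_derive t 1 (fun s : R => dot (grad l (x + s *: v)) v)
     (dot v (hess l (x + t *: v) *m v))).
Proof.
split=> t; first by apply: is_derive_line; have [] := l_C2.
have h i : is_derive t 1 (v i 0 \*: (fun s : R => grad l (x + s *: v) i 0))
    (v i 0 *: (hess l (x + t *: v) *m v) i 0).
  apply: is_deriveZ.
  have /= := is_derive_line (differentiable_gradi i (x + t *: v)).
  rewrite /dot; under eq_bigr do rewrite grad_grad.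
  by move=> ?; rewrite mxE.
have := is_derive_sum h.
rewrite (_ : \sum_i _ = fun s : R => dot (grad l (x + s *: v)) v)//.
apply/funext => s; rewrite fct_sumE; apply: eq_bigr => i _.
by rewrite mulrC.
Qed.

Lemma taylor_ge x v :
  delta / 2 * dot v v <= l (x + v) - l x - dot (grad l x) v.
Proof.
have [d1 d2] := line_derivatives x v.
have H : forall t : R, delta * dot v v <= dot v (hess l (x + t *: v) *m v).
  by move=> t; rewrite -dot_scalar_mx; exact: ((loewner_leE _ _).1 (hess_bounds _).1).
have := second_order_ge d1 d2 H.
by rewrite scale1r !scale0r addr0 mulrAC.
Qed.

Lemma taylor_le x v :
  l (x + v) - l x - dot (grad l x) v <= M / 2 * dot v v.
Proof.
have [d1 d2] := line_derivatives x v.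
have H : forall t : R, - (M * dot v v) <= - dot v (hess l (x + t *: v) *m v).
  move=> t; rewrite lerN2 -dot_scalar_mx.
  exact: ((loewner_leE _ _).1 (hess_bounds _).2).
have := second_order_ge (fun t => is_deriveN (d1 t)) (fun t => is_deriveN (d2 t)) H.
rewrite !fctE scale1r !scale0r addr0; lra.
Qed.

(** Three Taylor bounds are added: the lower one at [x] for the step [v + w], and the upper ones at
    [x + v] for [w] and at [x] for [v]. With [p] the difference of gradients, [w = - p / M]
    minimizes [<p, w> + M |w|^2 / 2] and leaves [|p|^2 / M <= M |v|^2]. *)
Lemma grad_lipschitz x v :
  dot (grad l (x + v) - grad l x) (grad l (x + v) - grad l x)
  <= M ^+ 2 * dot v v.
Proof.
set gy := grad l (x + v); set gx := grad l x; set p := gy - gx.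
pose w := (- M^-1) *: p.
have h1 := taylor_ge x (v + w); have h2 := taylor_le (x + v) w.
have h3 := taylor_le x v; have h4 : 0 <= delta / 2 * dot (v + w) (v + w).
  by rewrite mulr_ge0 ?dot_ge0// divr_ge0 ?ltW.
have pp : dot p p = dot gy p - dot gx p by rewrite {1}/p dotBl.
have h5 : dot gx w - dot gy w = M^-1 * dot p p by rewrite pp !dotZr; ring.
have h6 : M / 2 * dot w w = M^-1 * dot p p / 2.
  by rewrite dotZl dotZr; field; exact: lt0r_neq0.
have {}h1 := le_trans h4 h1; rewrite (addrA x) dotDr -/gx in h1.
rewrite h6 -/gy in h2; rewrite -/gx in h3.
have : M^-1 * dot p p <= M * dot v v by lra.
by rewrite ler_pdivrMl// mulrA -expr2.
Qed.

Lemma norm_gradB i x v (c : R) : 0 <= c -> dot v v <= c ^+ 2 ->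
  `|grad l (x + v) i 0 - grad l x i 0| <= M * c.
Proof.
move=> c0 vc; rewrite -(ler_pXn2r (ltn0Sn 1)) ?nnegrE ?mulr_ge0 ?(ltW M_gt0)//.
rewrite real_normK ?num_real// exprMn.
apply: (@le_trans _ _ (M ^+ 2 * dot v v)); last by rewrite ler_wpM2l ?sqr_ge0.
apply: le_trans (grad_lipschitz x v).
rewrite /dot (bigD1 i)//= !mxE -expr2 lerDl sumr_ge0// => j _.
by rewrite -expr2 sqr_ge0.
Qed.

End C2_theory.

End multivariate.

(** * Gaussian averages of the loss *)

Section gaussian_energy.
Context {R : realType} {d : nat}.
Implicit Types (x y v z m : 'cV[R]_d) (A B C : 'M[R]_d) (f : 'cV[R]_d -> R).

Definition mxdot A B : R := \sum_i \sum_j A i j * B i j.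

Lemma dot_le_norm1 x : dot x x <= norm1 x ^+ 2.
Proof.
rewrite expr2 {1}/norm1 mulr_suml; apply: ler_sum => i _.
rewrite -expr2 -real_normK ?num_real// expr2.
by rewrite ler_wpM2l// le_norm1.
Qed.

Lemma norm_dot_le x y : `|dot x y| <= norm1 x * norm1 y.
Proof.
rewrite mulr_suml; apply: le_trans (ler_norm_sum _ _ _) _; apply: ler_sum => i _.
by rewrite normrM ler_wpM2l// le_norm1.
Qed.

Lemma norm1Z (a : R) x : norm1 (a *: x) = `|a| * norm1 x.
Proof. by rewrite mulr_sumr; apply: eq_bigr => i _; rewrite mxE normrM. Qed.

Lemma is_derive_affine f m C z v : differentiable f (m + C *m z) ->
  is_derive z v (fun z => f (m + C *m z)) (dot (grad f (m + C *m z)) (C *m v)).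
Proof.
move=> df; have [dv dE] : is_derive (m + C *m z) (C *m v) f
    (dot (grad f (m + C *m z)) (C *m v)).
  by rewrite -derive_dot//; apply: DeriveDef => //; exact: diff_derivable.
have E : (fun h : R => h^-1 *: (((fun z => f (m + C *m z)) \o shift z) (h *: v)
      - f (m + C *m z))) =
    (fun h : R => h^-1 *: ((f \o shift (m + C *m z)) (h *: (C *m v))
      - f (m + C *m z))).
  apply/funext => h /=; congr (_ *: (f _ - _)).
  by rewrite mulmxDr -scalemxAr addrCA.
by split; rewrite /derivable /derive E.
Qed.

Lemma exp_growth_affine_coord (a : R) (b : 'I_d -> R) :
  exp_growth (fun z => a + \sum_j b j * z j 0).
Proof.
apply: exp_growthD; first exact: exp_growth_cst.
by apply: exp_growth_sum => j; apply: exp_growthZ; exact: exp_growth_coord.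
Qed.

(** Used with the gradient of the loss as [u], and with the affine map itself to compute its second
    moment. *)
Lemma std_E_dot_affine (u : 'I_d -> 'cV[R]_d -> R) (q : 'I_d -> R)
    (P : 'M[R]_d) (a : 'cV[R]_d) B :
  (forall i, exp_growth (u i)) -> (forall i, std_E (u i) = q i) ->
  (forall i j, std_E (fun z => u i z * z j 0) = P i j) ->
  std_E (fun z => \sum_i u i z * (a + B *m z) i 0) =
  \sum_i q i * a i 0 + mxdot P B.
Proof.
move=> gu uq uP; have gz i j : exp_growth (fun z => u i z * z j 0).
  by apply: exp_growthM => //; exact: exp_growth_coord.
have gB i j : exp_growth (fun z => B i j * (u i z * z j 0)) by exact: exp_growthZ.
have E i z : u i z * (a + B *m z) i 0 =
    a i 0 * u i z + \sum_j B i j * (u i z * z j 0).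
  rewrite !mxE mulrDr mulrC mulr_sumr; congr (_ + _).
  by apply: eq_bigr => j _; rewrite mulrCA.
under eq_fun do under eq_bigr do rewrite E.
rewrite std_E_sum => [|i]; last first.
  by apply: exp_growthD; [exact: exp_growthZ|exact: exp_growth_sum].
rewrite -big_split/=; apply: eq_bigr => i _.
rewrite std_ED ?std_EZ ?std_E_sum//; last 2 first.
- exact: exp_growthZ.
- exact: exp_growth_sum.
rewrite uq mulrC; congr (_ + _); apply: eq_bigr => j _.
by rewrite std_EZ// uP mulrC.
Qed.

Lemma is_derive_affine_fun f z v (c : R) :
  (forall h : R, f (h *: v + z) = f z + h * c) -> is_derive z v f c.
Proof.
move=> fE; have cb : h^-1 *: ((f \o shift z) (h *: v) - f z) @[h --> (0:R)^'] --> c.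
  apply: cvg_near_cst; near=> h.
  rewrite /= fE addrAC subrr add0r /GRing.scale/= mulKf//.
  by near: h; exact: nbhs_dnbhs_neq.
by split; [apply/cvg_ex; exists c|exact: cvg_lim cb].
Unshelve. all: by end_near. Qed.

(** The Gaussian moments of order one and two are also drawn from Stein's identity, the derivative
    of an affine function being constant. *)
Lemma stein_affine_coord (a : R) (b : 'I_d -> R) j :
  std_E (fun z : 'cV[R]_d => (a + \sum_k b k * z k 0) * z j 0) = b j.
Proof.
have lin z (h : R) : a + \sum_k b k * (h *: delta_mx j 0 + z) k 0 =
    a + \sum_k b k * z k 0 + h * b j.
  rewrite -addrA; congr (_ + _).
  under eq_bigr do rewrite !mxE mulrDr.
  rewrite big_split/= addrC; congr (_ + _).
  rewrite (bigD1 j)//= eqxx big1 => [|k kj].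
    by rewrite mulr1 addr0 mulrC.
  by rewrite (negbTE kj) !mulr0.
have der z : is_derive z (delta_mx j 0 : 'cV[R]_d)
    (fun z => a + \sum_k b k * z k 0) (b j).
  by apply: is_derive_affine_fun => h; exact: lin.
have := stein (L := `|b j|) (exp_growth_affine_coord a b) (measurable_cst (b j)) der.
rewrite std_E_cst; apply => z h.
by rewrite lin addrAC subrr add0r normrM mulrC.
Qed.

Lemma std_E_affine_coord (a : R) (b : 'I_d -> R) :
  std_E (fun z : 'cV[R]_d => a + \sum_k b k * z k 0) = a.
Proof.
(* The mean vanishes by the identity for the constant function 1. *)
have z0 j : std_E (fun z : 'cV[R]_d => z j 0) = 0.
  rewrite -[RHS](stein_affine_coord 1 (fun=> 0) j); congr std_E.
  by apply/funext => z; rewrite big1 ?addr0 ?mul1r// => k _; rewrite mul0r.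
rewrite (std_ED (f := fun=> a)) ?std_E_cst; last 2 first.
- exact: exp_growth_cst.
- by apply: exp_growth_sum => j; apply: exp_growthZ; exact: exp_growth_coord.
rewrite std_E_sum => [|j]; last by apply: exp_growthZ; exact: exp_growth_coord.
rewrite big1 ?addr0// => j _.
by rewrite std_EZ ?z0 ?mulr0//; exact: exp_growth_coord.
Qed.

Lemma std_E_sqr_affine (a : 'cV[R]_d) B :
  std_E (fun z => dot (a + B *m z) (a + B *m z)) = dot a a + mxdot B B.
Proof.
have E i z : (a + B *m z) i 0 = a i 0 + \sum_j B i j * z j 0 by rewrite !mxE.
rewrite /dot (std_E_dot_affine (u := fun i z => (a + B *m z) i 0)
  (q := fun i => a i 0) (P := B))// => [i|i|i j].
- by under eq_fun do rewrite E; exact: exp_growth_affine_coord.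
- by under eq_fun do rewrite E; exact: std_E_affine_coord.
- by under eq_fun do rewrite E; exact: stein_affine_coord.
Qed.

End gaussian_energy.

(** * Convexity and smoothness of the averaged loss *)

Section energy_bounds.
Context {R : realType} {d : nat}.
Variables (l : 'cV[R]_d -> R) (delta M : R).
Hypothesis l_C2 : C2 l.
Hypothesis M_gt0 : 0 < M.
Hypothesis delta_gt0 : 0 < delta.
Hypothesis hess_bounds : forall x,
  loewner_le delta%:M (hess l x) /\ loewner_le (hess l x) M%:M.
Implicit Types (x y v z m : 'cV[R]_d) (A B C : 'M[R]_d).

Let l_measurable : cV_measurable l.
Proof.
apply: continuous_measurable_cV => x.
by apply: differentiable_continuous; have [] := l_C2.
Qed.

Let gradi_measurable i : cV_measurable (fun x => grad l x i 0).
Proof.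
apply: continuous_measurable_cV => x; apply: differentiable_continuous.
exact: differentiable_gradi.
Qed.

Let hess_measurable i j : cV_measurable (fun x => hess l x i j).
Proof.
have [_ _ ch] := l_C2; apply: continuous_measurable_cV => x.
apply: (@continuous_comp _ _ _ (hess l) (fun A : 'M[R]_d => A i j)).
  exact: ch.
exact: coord_continuous.
Qed.

(** The Taylor bounds at the origin enclose [l] between an affine function and a quadratic one. *)
Lemma exp_growth_loss : exp_growth l.
Proof.
pose G := norm1 (grad l 0).
apply: (@exp_growth_quad _ _ _ (`|l 0| + G) (G + M / 2)) => //.
- by rewrite addr_ge0// norm1_ge0.
- by rewrite addr_ge0 ?norm1_ge0// divr_ge0// ltW.
move=> x; have := taylor_le l_C2 hess_bounds 0 x.
have := taylor_ge l_C2 hess_bounds 0 x; rewrite add0r.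
have d0 : 0 <= delta / 2 * dot x x by rewrite mulr_ge0 ?dot_ge0// divr_ge0// ltW.
have d1 : M / 2 * dot x x <= M / 2 * norm1 x ^+ 2.
  by rewrite ler_wpM2l ?dot_le_norm1// divr_ge0// ltW.
have := norm_dot_le (grad l 0) x; rewrite -/G ler_norml => /andP[g1 g2].
have n0 := norm1_ge0 x; have G0 : 0 <= G by exact: norm1_ge0.
have g3 : G * norm1 x <= G * (1 + norm1 x ^+ 2).
  by rewrite ler_wpM2l//; have := sqr_ge0 (norm1 x - 1); nra.
have := ler_norm (l 0); have := ler_norm (- l 0); rewrite normrN.
by move=> *; rewrite ler_norml; apply/andP; split; lra.
Qed.

Lemma exp_growth_gradi i : exp_growth (fun x => grad l x i 0).
Proof.
apply: (@exp_growth_quad _ _ _ (`|grad l 0 i 0| + M) M) => //.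
- by rewrite addr_ge0// ltW.
- exact: ltW.
move=> x; have n0 := norm1_ge0 x.
have := norm_gradB l_C2 M_gt0 delta_gt0 hess_bounds i 0 n0 (dot_le_norm1 x).
rewrite add0r => h.
have g3 : M * norm1 x <= M * (1 + norm1 x ^+ 2).
  by rewrite ler_wpM2l ?(ltW M_gt0)//; have := sqr_ge0 (norm1 x - 1); nra.
rewrite -[X in `|X|](subrK (grad l 0 i 0)).
by apply: le_trans (ler_normD _ _) _; lra.
Qed.

Let gradi_line i x v (h : R) :
  `|grad l (x + h *: v) i 0 - grad l x i 0| <= M * norm1 v * `|h|.
Proof.
rewrite -mulrA (mulrC (norm1 v)) -norm1Z; apply: (norm_gradB (delta := delta)) => //.
  exact: norm1_ge0.
exact: dot_le_norm1.
Qed.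

(* The Loewner bounds control the off-diagonal entries only for a symmetric
   Hessian; the Lipschitz bound on the gradient avoids proving symmetry. *)
Lemma hess_norm_le i j x : `|hess l x i j| <= M.
Proof.
pose e : 'cV[R]_d := delta_mx j 0.
have d1 : is_derive x e (fun y => grad l y i 0) (hess l x i j).
  have dg := differentiable_gradi l_C2 i x.
  rewrite -grad_grad mxE; apply: DeriveDef => //; exact: diff_derivable.
have e1 : norm1 e = 1.
  rewrite /norm1 (bigD1 j)//= big1 => [|k kj].
    by rewrite mxE !eqxx normr1 addr0.
  by rewrite mxE (negbTE kj) normr0.
have /cvg_norm c := cvg_diff_quotient d1.
rewrite -(cvg_lim _ c)//; apply: limr_le.
  by apply/cvg_ex; exists `|hess l x i j|; exact: c.
apply: nearW => n.
have h0 : 0 < harmonic n :> R by rewrite /harmonic invr_gt0.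
rewrite normrM gtr0_norm ?invr_gt0// ler_pdivrMl// (addrC _ x).
by apply: le_trans (gradi_line _ _ _ _) _; rewrite e1 mulr1 gtr0_norm// mulrC.
Qed.

Lemma exp_growth_hess i j : exp_growth (fun x => hess l x i j).
Proof.
split=> //; exists M, 0; split=> // [|x]; first exact: ltW.
by rewrite mul0r expR0 mulr1 hess_norm_le.
Qed.

Definition energy m C : R := std_E (fun z => l (m + C *m z)).

Section fixed_point.
Variables (m : 'cV[R]_d) (C : 'M[R]_d).
Hypothesis mC : Omega (m, C).
Let g := gauss_E_mx m (C *m C^T) (grad l).
Let H := gauss_E_mx m (C *m C^T) (hess l).

Let std_E_gradi i : std_E (fun z => grad l (m + C *m z) i 0) = g i 0.
Proof. by rewrite mxE (gauss_E_affine mC). Qed.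

Let std_E_hess i j : std_E (fun z => hess l (m + C *m z) i j) = H i j.
Proof. by rewrite mxE (gauss_E_affine mC). Qed.

(** The derivative of [grad l (m + C z)] in the coordinate [j] of [z] is the Hessian times column
    [j] of [C], so Stein's identity applies. This is how [H C] arises as the gradient of the energy
    in [C]. *)
Let stein_gradi i j :
  std_E (fun z => grad l (m + C *m z) i 0 * z j 0) = (H *m C) i j.
Proof.
have gh k : exp_growth (fun z => hess l (m + C *m z) i k).
  exact: (exp_growth_affine m C (exp_growth_hess i k)).
have gch k : exp_growth (fun z => C k j * hess l (m + C *m z) i k).
  exact: exp_growthZ.
pose du z := \sum_k C k j * hess l (m + C *m z) i k.
have der z : is_derive z (delta_mx j 0 : 'cV[R]_d)
    (fun z => grad l (m + C *m z) i 0) (du z).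
  have := is_derive_affine (delta_mx j 0) (differentiable_gradi l_C2 i (m + C *m z)).
  rewrite (_ : dot _ _ = du z)//; apply: eq_bigr => k _.
  by rewrite grad_grad -colE [col _ _ _ _]mxE mulrC.
rewrite (_ : (H *m C) i j = std_E du).
  have gg := exp_growth_affine m C (exp_growth_gradi i).
  apply: (stein (L := M * norm1 (C *m delta_mx j 0)) gg _ der).
    exact: (exp_growth_sum _ _ gch).1.
  move=> z h; rewrite (_ : m + C *m _ = m + C *m z + h *: (C *m delta_mx j 0)).
    exact: gradi_line.
  by rewrite mulmxDr -scalemxAr [X in m + X]addrC addrA.
rewrite std_E_sum// mxE; apply: eq_bigr => k _.
by rewrite std_EZ// std_E_hess mulrC.
Qed.

(** The pointwise Taylor bounds are averaged over the random displacement [v z]. Its mean square is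
    [N], and Stein's identity turns the average of [<grad l, v z>] into the linear terms subtracted
    in [D]. *)
Lemma energy_bounds m' C' (N D : R) :
  N = dot (m' - m) (m' - m) + mxdot (C' - C) (C' - C) ->
  D = energy m' C' - energy m C - dot g (m' - m) - mxdot (H *m C) (C' - C) ->
  delta / 2 * N <= D <= M / 2 * N.
Proof.
move=> NE DE; pose v z := (m' - m) + (C' - C) *m z.
have Ev z : m' + C' *m z = (m + C *m z) + v z.
  by rewrite /v mulmxBl addrACA subrKC subrKC.
pose q z := dot (grad l (m + C *m z)) (v z).
have gv i : exp_growth (fun z => v z i 0).
  rewrite (_ : (fun z => v z i 0) = fun z =>
    (m' - m) i 0 + \sum_j (C' - C) i j * z j 0); first exact: exp_growth_affine_coord.
  by apply/funext => z; rewrite /v [LHS]mxE; congr (_ + _); rewrite mxE.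
have gq : exp_growth q.
  apply: exp_growth_sum => i; apply: exp_growthM => //.
  exact: (exp_growth_affine m C (exp_growth_gradi i)).
have gN : exp_growth (fun z => dot (v z) (v z)).
  by apply: exp_growth_sum => i; exact: exp_growthM.
have gl' := exp_growth_affine m' C' exp_growth_loss.
have gl := exp_growth_affine m C exp_growth_loss.
have Eq : std_E q = dot g (m' - m) + mxdot (H *m C) (C' - C).
  apply: std_E_dot_affine => //= i.
  exact: (exp_growth_affine m C (exp_growth_gradi i)).
have EN : std_E (fun z => dot (v z) (v z)) = N.
  by rewrite NE; exact: std_E_sqr_affine.
have gll := exp_growthB gl' gl.
have ED : std_E (fun z => l (m' + C' *m z) - l (m + C *m z) - q z) = D.
  by rewrite DE std_EB// std_EB// Eq opprD addrA.
apply/andP; split; rewrite -ED -EN -std_EZ//; apply: le_std_E.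
- exact: exp_growthZ.
- exact: exp_growthB.
- by move=> z; rewrite Ev; exact: taylor_ge.
- exact: exp_growthB.
- exact: exp_growthZ.
- by move=> z; rewrite Ev; exact: taylor_le.
Qed.

Lemma mean_hess_bounds v :
  delta * dot v v <= dot v (H *m v) <= M * dot v v.
Proof.
have gh i j : exp_growth (fun z => hess l (m + C *m z) i j).
  exact: (exp_growth_affine m C (exp_growth_hess i j)).
have gv i j : exp_growth (fun z => v i 0 * v j 0 * hess l (m + C *m z) i j).
  exact: exp_growthZ.
pose q z := \sum_i \sum_j v i 0 * v j 0 * hess l (m + C *m z) i j.
have qE z : q z = dot v (hess l (m + C *m z) *m v).
  apply: eq_bigr => i _; rewrite [(_ *m v) i 0]mxE mulr_sumr.
  by apply: eq_bigr => j _; rewrite -mulrA (mulrC (v j 0)).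
have gq : exp_growth q.
  by apply: exp_growth_sum => i; exact: exp_growth_sum.
have Eq : std_E q = dot v (H *m v).
  rewrite std_E_sum; last by move=> i; exact: exp_growth_sum.
  apply: eq_bigr => i _; rewrite std_E_sum// mxE mulr_sumr.
  apply: eq_bigr => j _; rewrite std_EZ// std_E_hess.
  by rewrite -mulrA (mulrC (v j 0)).
rewrite -Eq -(std_E_cst (d := d) (delta * _)) -(std_E_cst (d := d) (M * _)).
have gc c : exp_growth (fun _ : 'cV[R]_d => c) by exact: exp_growth_cst.
apply/andP; split; apply: le_std_E => // z; rewrite qE -dot_scalar_mx.
  exact: ((loewner_leE _ _).1 (hess_bounds _).1).
exact: ((loewner_leE _ _).1 (hess_bounds _).2).
Qed.

(** At [m + C z] the density is the standard density at [z] divided by [\det C]. The first term is a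
    constant that cancels in differences of losses. *)
Lemma VI_loss_energy :
  VI_loss l (m, C) =
  std_E (fun z : 'cV[R]_d => ln (gauss_pdf 0 1%:M z)) + energy m C - ln (\det C).
Proof.
have C0 := Omega_det_gt0 mC.
rewrite /VI_loss/= (gauss_E_affine mC); last first.
  apply: measurable_funD => //; apply: (measurableT_comp (f := @ln R)).
    exact: measurable_ln.
  exact: measurable_gauss_pdf.
have lnE z : ln (gauss_pdf m (C *m C^T) (m + C *m z)) =
    ln (gauss_pdf 0 1%:M z) - ln (\det C).
  have p0 := gauss_pdf_gt0 (m + C *m z) mC.
  rewrite -(gauss_pdf_affine z mC) (@lnM _ (\det C)) ?posrE//.
  by rewrite addrAC subrr add0r.
under eq_fun do rewrite lnE addrA.
have gp : exp_growth (fun z : 'cV[R]_d => ln (gauss_pdf 0 1%:M z)).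
  have w0 : 0 < (Num.sqrt ((2 * pi) ^+ d * \det (1%:M : 'M[R]_d)))^-1 :> R.
    by rewrite det1 mulr1 invr_gt0 sqrtr_gt0 exprn_gt0 ?mulr_gt0 ?pi_gt0.
  have E z : ln (gauss_pdf 0 1%:M z) =
      ln (Num.sqrt ((2 * pi) ^+ d * \det (1%:M : 'M[R]_d)))^-1 +
      - (1 / 2) * \sum_i z i 0 * z i 0 :> R.
    rewrite /gauss_pdf lnM ?posrE ?expR_gt0// expRK.
    by rewrite subr0 invmx1 mulmx1 mulmx_dot.
  under eq_fun do rewrite E.
  apply: exp_growthD; first exact: exp_growth_cst.
  apply: exp_growthZ; apply: exp_growth_sum => i.
  by apply: exp_growthM; exact: exp_growth_coord.
have gl := exp_growth_affine m C exp_growth_loss.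
have gc := exp_growth_cst (d := d) (- ln (\det C)).
rewrite std_ED//; last exact: exp_growthD.
by rewrite std_ED// std_E_cst; congr (_ - _); exact: addrC.
Qed.

End fixed_point.

End energy_bounds.

(** * Logarithmic barrier *)

Section logarithm_bounds.
Context {R : realType}.
Implicit Types (f df : R -> R) (w x s mu p rho : R).

Lemma nondecreasing_pos f df (a b : R) :
  (forall x, 0 < x -> is_derive x 1 f (df x)) ->
  (forall x, 0 < x -> 0 <= df x) -> 0 < a -> a <= b -> f a <= f b.
Proof.
move=> dfx df0 a0; rewrite le_eqVlt => /predU1P[->//|ab].
have pos x : x \in `[a, b] -> 0 < x.
  by rewrite in_itv/= => /andP[ax _]; exact: lt_le_trans ax.
have dI x (xab : x \in `]a, b[) : is_derive x 1 f (df x).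
  by apply: dfx; apply: pos; exact: subset_itv_oo_cc.
have cf : {within `[a, b], continuous f}.
  apply: derivable_within_continuous => x /pos x0.
  by have [] := dfx x x0.
have [c cab fab] := @MVT R f df a b ab dI cf.
have c0 := pos _ (subset_itv_oo_cc cab).
by rewrite -subr_ge0 fab mulr_ge0 ?df0// subr_ge0 ltW.
Qed.

(** This function vanishes at 1 and has a nonnegative derivative, so it is nonpositive before 1 and
    nonnegative after; both hyperbolic bounds on [ln] follow. *)
Lemma is_derive_ln_hyperbolic w : 0 < w ->
  is_derive w 1 (fun x : R => (x - x^-1) / 2 - ln x) ((1 - w^-1) ^+ 2 / 2).
Proof.
move=> w0; have wn0 : w != 0 by rewrite gt_eqF.
have dln := is_derive1_ln w0.
have dV : is_derive w 1 (fun x : R => x^-1) (- w ^- 2).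
  by have := is_deriveV (f := id) wn0 (is_derive_id w 1); rewrite scaler1.
have := is_deriveB (is_deriveZ (1 / 2) (is_deriveB (is_derive_id w 1) dV)) dln.
rewrite (_ : _ - _ = fun x => (x - x^-1) / 2 - ln x); last first.
  apply/funext => x; rewrite /= !fctE; congr (_ - _).
  by rewrite /GRing.scale/= div1r mulrC.
by move=> h; apply: is_derive_eq h _; rewrite /GRing.scale/=; field.
Qed.

(** The error of the second-order expansion of [ln] at 1 is treated in the same way. *)
Lemma is_derive_ln_quadratic w : 0 < w ->
  is_derive w 1 (fun x : R => ln x - (x - 1) + (x - 1) ^+ 2 / 2)
    ((w - 1) ^+ 2 / w).
Proof.
move=> w0; have wn0 : w != 0 by rewrite gt_eqF.
have dln := is_derive1_ln w0.
have d1 : is_derive w 1 (id - cst 1 : R -> R) 1.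
  have := is_deriveB (is_derive_id w (1 : R)) (is_derive_cst (1 : R) w 1).
  by rewrite subr0.
have := is_deriveD (is_deriveB dln d1) (is_deriveZ (1 / 2) (is_deriveX 2 d1)).
rewrite (_ : _ + _ = fun x => ln x - (x - 1) + (x - 1) ^+ 2 / 2); last first.
  apply/funext => x; rewrite /= !fctE; congr (_ + _).
  by rewrite /GRing.scale/= div1r mulrC.
move=> h; apply: is_derive_eq h _.
by rewrite /GRing.scale/= !fctE expr1; field.
Qed.

Lemma ln_le_hyperbolic w : 1 <= w -> ln w <= (w - w^-1) / 2.
Proof.
move=> w1; have := nondecreasing_pos is_derive_ln_hyperbolic _ ltr01 w1.
rewrite ln1 invr1 subrr mul0r subr0 subr_ge0; apply => x x0.
by rewrite divr_ge0 ?sqr_ge0.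
Qed.

Lemma ln_ge_hyperbolic w : 0 < w -> w <= 1 -> (w - w^-1) / 2 <= ln w.
Proof.
move=> w0 w1; have := nondecreasing_pos is_derive_ln_hyperbolic _ w0 w1.
rewrite ln1 invr1 subrr mul0r subr0 subr_le0; apply => x x0.
by rewrite divr_ge0 ?sqr_ge0.
Qed.

Lemma ln_le_quadratic w : 0 < w -> w <= 1 -> ln w <= (w - 1) - (w - 1) ^+ 2 / 2.
Proof.
move=> w0 w1; have := nondecreasing_pos is_derive_ln_quadratic _ w0 w1.
rewrite ln1 subrr expr0n/= mul0r subr0 addr0 => H.
suff : ln w - (w - 1) + (w - 1) ^+ 2 / 2 <= 0 by lra.
by apply: H => x x0; rewrite divr_ge0 ?sqr_ge0// ltW.
Qed.

Lemma ln_ge_quadratic w : 1 <= w -> (w - 1) - (w - 1) ^+ 2 / 2 <= ln w.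
Proof.
move=> w1; have := nondecreasing_pos is_derive_ln_quadratic _ ltr01 w1.
rewrite ln1 subrr expr0n/= mul0r subr0 addr0 => H.
suff : 0 <= ln w - (w - 1) + (w - 1) ^+ 2 / 2 by lra.
by apply: H => x x0; rewrite divr_ge0 ?sqr_ge0// ltW.
Qed.

Lemma quad_max (a x mu : R) : 0 < mu -> a * x - mu * x ^+ 2 <= a ^+ 2 / (4 * mu).
Proof.
move=> mu0; have -> : a ^+ 2 / (4 * mu) =
    a * x - mu * x ^+ 2 + (a - 2 * mu * x) ^+ 2 / (4 * mu).
  by field; rewrite gt_eqF.
by rewrite lerDl divr_ge0 ?sqr_ge0// mulr_ge0// ltW.
Qed.

(* The concavity of [ln] contributes a second [mu x^2 / 2]; this is what makes
   up for the factor 1/2 on the diagonal of [tril]. For very negative [x] it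
   does not, and there [s >= mu - 1] is needed. *)
Lemma log_barrier_conjugate mu s x : 0 < mu -> mu <= 1 -> mu - 1 <= s -> x < 1 ->
  s * x + x + ln (1 - x) - mu / 2 * x ^+ 2 <= s ^+ 2 / (4 * mu).
Proof.
move=> mu0 mu1 smu x1; have w0 : 0 < 1 - x by lra.
have x2 := sqr_ge0 x.
(* For [x >= 0], [ln (1 - x) <= - x - x^2 / 2]; the coefficient of [- x^2] becomes [(1 + mu) / 2],
   which is at least [mu]. *)
have [x0|x0] := leP 0 x.
  apply: (le_trans _ (quad_max s x mu0)).
  have := ln_le_quadratic w0; rewrite (_ : 1 - x - 1 = - x); last by ring.
  have : 0 <= (1 - mu) * x ^+ 2 by rewrite mulr_ge0 ?sqr_ge0//; lra.
  have w1 : 1 - x <= 1 by lra.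
  by move=> h /(_ w1); rewrite sqrrN; lra.
(* For [x < 0] with [mu (1 - x) <= 1], the hyperbolic bound gains [x^2 / (2 (1 - x))], which is at
   least [mu x^2 / 2]. *)
have [wmu|wmu] := leP (mu * (1 - x)) 1.
  apply: (le_trans _ (quad_max s x mu0)).
  have w1 : 1 <= 1 - x by lra.
  have := ln_le_hyperbolic w1.
  have -> : (1 - x - (1 - x)^-1) / 2 = - x - x ^+ 2 * (1 - x)^-1 / 2.
    by field; rewrite gt_eqF.
  have : x ^+ 2 * mu <= x ^+ 2 * (1 - x)^-1.
    by rewrite ler_wpM2l// -div1r ler_pdivlMr.
  lra.
(* Beyond the threshold [x = 1 - k], [ln] is bounded by its tangent at [k], and the left-hand side
   is compared with the concave quadratic at the threshold; [s >= mu - 1] controls the linear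
   term. *)
pose k := mu^-1; have kmu : k * mu = 1 by rewrite mulVf// gt_eqF.
apply: (le_trans _ (quad_max s (1 - k) mu0)).
have lnw : ln (1 - x) <= mu * (1 - x) - 1 + (k - mu) / 2.
  have l1 := ln_ge_hyperbolic mu0 mu1; rewrite -/k in l1.
  have : ln (mu * (1 - x)) = ln mu + ln (1 - x) by rewrite lnM ?posrE.
  have := expR_ge1Dx (ln (mu * (1 - x))); rewrite lnK ?posrE ?mulr_gt0//; lra.
have xk : x <= 1 - k.
  by have : k <= 1 - x; [rewrite /k -div1r ler_pdivrMr// mulrC ltW|lra].
have k1 : 1 <= k by rewrite /k -div1r ler_pdivlMr ?mul1r.
have sx : 0 <= (s + 1 - mu) * (1 - k - x) by apply: mulr_ge0; lra.
have sq : 0 <= mu * ((1 - k - x) * (- (1 - k) - x)).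
  by rewrite mulr_ge0 ?(ltW mu0)// mulr_ge0; lra.
have muk2 : mu * k ^+ 2 = k by rewrite expr2 mulrA (mulrC mu) kmu mul1r.
have muk : mu * k = 1 by rewrite mulrC.
nra.
Qed.

(** Plays the part of smoothness for the barrier. With [x = rho s / 2] the hypotheses force
    [p (1 - x) >= 1], so the factor [1 / (1 - x)] in the hyperbolic bound is at most [p] when
    [x >= 0]; for [x < 0] the quadratic bound and [p >= 1] suffice. *)
Lemma log_barrier_smooth p rho s : 0 < rho -> 1 <= p -> rho * p <= 2 -> s <= p - 1 ->
  0 < 1 - rho * (s / 2) /\
  - ln (1 - rho * (s / 2)) - rho * (s / 2) <= p / 2 * (rho * (s / 2)) ^+ 2.
Proof.
move=> rho0 p1 rp sp; set x := rho * (s / 2).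
have px : 1 <= p * (1 - x).
  have : rho * s <= rho * (p - 1) by rewrite ler_pM2l.
  have : rho * p * (p - 1) <= 2 * (p - 1) by rewrite ler_wpM2r//; lra.
  have : p * (rho * s) <= p * (rho * (p - 1)) by rewrite ler_wpM2l ?ler_pM2l//; lra.
  by rewrite /x; nra.
have w0 : 0 < 1 - x.
  by rewrite -(pmulr_rgt0 _ (lt_le_trans ltr01 p1)); lra.
split=> //; have x2 := sqr_ge0 x.
have [x0|x0] := leP 0 x.
  have w1 : 1 - x <= 1 by lra.
  have := ln_ge_hyperbolic w0 w1.
  have -> : (1 - x - (1 - x)^-1) / 2 = - x - x ^+ 2 * (1 - x)^-1 / 2.
    by field; rewrite gt_eqF.
  have : x ^+ 2 * (1 - x)^-1 <= x ^+ 2 * p.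
    by rewrite ler_wpM2l// -div1r ler_pdivrMr.
  lra.
have w1 : 1 <= 1 - x by lra.
have := ln_ge_quadratic w1; rewrite (_ : 1 - x - 1 = - x); last by ring.
have : x ^+ 2 <= p * x ^+ 2 by rewrite ler_peMl.
rewrite sqrrN; lra.
Qed.

End logarithm_bounds.

(** * Triangular matrices *)

Section matrix_inner_product.
Context {R : realType} {d : nat}.
Implicit Types (x y : 'cV[R]_d) (A B C : 'M[R]_d).

Lemma mxdotDl A B C : mxdot (A + B) C = mxdot A C + mxdot B C.
Proof.
rewrite /mxdot -big_split; apply: eq_bigr => i _; rewrite -big_split/=.
by apply: eq_bigr => j _; rewrite mxE mulrDl.
Qed.

Lemma mxdotZr (a : R) A B : mxdot A (a *: B) = a * mxdot A B.
Proof.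
rewrite /mxdot mulr_sumr; apply: eq_bigr => i _; rewrite mulr_sumr.
by apply: eq_bigr => j _; rewrite mxE mulrCA.
Qed.

Lemma mxdotC A B : mxdot A B = mxdot B A.
Proof. by apply: eq_bigr => i _; apply: eq_bigr => j _; rewrite mulrC. Qed.

Lemma mxdot_col A B : mxdot A B = \sum_j dot (col j A) (col j B).
Proof.
rewrite /mxdot exchange_big; apply: eq_bigr => j _.
by apply: eq_bigr => i _; rewrite !mxE.
Qed.

Lemma col_mulmx j A B : col j (A *m B) = A *m col j B.
Proof. by rewrite !colE mulmxA. Qed.

Lemma dot_mulmx A x y : dot (A *m x) y = dot x (A^T *m y).
Proof. by rewrite -!mulmx_dot trmx_mul mulmxA. Qed.

Lemma mxdot_mulmx A B C : mxdot A (C *m B) = mxdot (C^T *m A) B.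
Proof.
rewrite !mxdot_col; apply: eq_bigr => j _.
by rewrite !col_mulmx dotC dot_mulmx dotC.
Qed.

Lemma mxdot1 A : mxdot 1%:M A = \sum_i A i i.
Proof.
apply: eq_bigr => i _; rewrite (bigD1 i)//= mxE eqxx mul1r big1 ?addr0// => j ij.
by rewrite mxE eq_sym (negbTE ij) mul0r.
Qed.

Lemma mxdot_ge0 A : 0 <= mxdot A A.
Proof. by rewrite mxdot_col; apply: sumr_ge0 => j _; exact: dot_ge0. Qed.

Lemma mxdot_tr A B : mxdot A^T B^T = mxdot A B.
Proof.
rewrite /mxdot exchange_big; apply: eq_bigr => i _.
by apply: eq_bigr => j _; rewrite !mxE.
Qed.

Lemma cauchy_schwarz_sum (a b : 'I_d -> R) :
  (\sum_i a i * b i) ^+ 2 <= (\sum_i a i ^+ 2) * (\sum_i b i ^+ 2).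
Proof.
have : 0 <= \sum_i \sum_j (a i * b j - a j * b i) ^+ 2.
  by apply: sumr_ge0 => i _; apply: sumr_ge0 => j _; exact: sqr_ge0.
have -> : \sum_i \sum_j (a i * b j - a j * b i) ^+ 2 =
    \sum_i \sum_j a i ^+ 2 * b j ^+ 2 + \sum_i \sum_j a j ^+ 2 * b i ^+ 2
    - 2 * \sum_i \sum_j (a i * b i) * (a j * b j).
  rewrite mulr_sumr -sumrN -!big_split/=; apply: eq_bigr => i _.
  rewrite mulr_sumr -sumrN -!big_split/=; apply: eq_bigr => j _.
  by ring.
rewrite [X in _ + X - _]exchange_big -!big_distrlr/= -expr2; lra.
Qed.

Lemma dot_mulmx_le C x : dot (C *m x) (C *m x) <= mxdot C C * dot x x.
Proof.
rewrite /mxdot mulr_suml; apply: ler_sum => i _.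
rewrite -expr2 mxE; apply: le_trans (cauchy_schwarz_sum _ _) _.
by under eq_bigr do rewrite expr2; under [X in _ * X]eq_bigr do rewrite expr2.
Qed.

Lemma mxdot_mulmx_le C A : mxdot (C *m A) (C *m A) <= mxdot C C * mxdot A A.
Proof.
rewrite !(mxdot_col _ (_ *m _)) (mxdot_col A) mulr_sumr; apply: ler_sum => j _.
by rewrite !col_mulmx dot_mulmx_le.
Qed.

(* [C C^T] and [C^T C] have the same eigenvalues. *)
Lemma dot_mulmx_ge C (lam : R) x : C \in unitmx -> 0 <= lam ->
  loewner_le lam%:M (C *m C^T) -> lam * dot x x <= dot (C *m x) (C *m x).
Proof.
move=> uC lam0 /loewner_leE CC.
pose y := invmx C^T *m x.
have Cy : C^T *m y = x by rewrite mulKVmx// unitmx_tr.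
have := CC y; rewrite dot_scalar_mx -mulmxA dotC dot_mulmx Cy => lamy.
have Cxy : dot (C *m x) y = dot x x by rewrite dot_mulmx Cy.
(* To be expanded with [<C x, y> = |x|^2] and [lam |y|^2 <= |x|^2]. *)
have : 0 <= dot (C *m x - lam *: y) (C *m x - lam *: y) by exact: dot_ge0.
rewrite dotBl !dotBr !dotZl !dotZr (dotC y) Cxy.
have : lam * (lam * dot y y) <= lam * dot x x by rewrite ler_wpM2l.
lra.
Qed.

Lemma mxdot_mulmx_ge C (lam : R) A : C \in unitmx -> 0 <= lam ->
  loewner_le lam%:M (C *m C^T) -> lam * mxdot A A <= mxdot (C *m A) (C *m A).
Proof.
move=> uC lam0 CC; rewrite !mxdot_col mulr_sumr; apply: ler_sum => j _.
by rewrite !col_mulmx dot_mulmx_ge.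
Qed.

End matrix_inner_product.

Section triangular_matrices.
Context {R : realType} {d : nat}.
Implicit Types A B C : 'M[R]_d.

Lemma trig_mulmx_diag A B i : is_trig_mx A -> is_trig_mx B ->
  (A *m B) i i = A i i * B i i.
Proof.
move=> /is_trig_mxP tA /is_trig_mxP tB; rewrite mxE (bigD1 i)//= big1 ?addr0//.
move=> k; rewrite -val_eqE/= neq_ltn => /orP[ki|ik].
  by rewrite tB ?mulr0.
by rewrite tA ?mul0r.
Qed.

(** Forward substitution: once the rows of [B] above row [i] are known to be triangular, the entry
    [(i, j)] of the product reduces to [A i i * B i j]. *)
Lemma trig_mulmxV A B : is_trig_mx A -> (forall i, A i i != 0) ->
  is_trig_mx (A *m B) -> is_trig_mx B.
Proof.
move=> /is_trig_mxP tA A0 /is_trig_mxP tAB; apply/is_trig_mxP => i.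
have [n] := ubnP i; elim: n i => // n IH i; rewrite ltnS => ni j ij.
have := tAB i j ij; rewrite mxE (bigD1 i)//= big1 ?addr0 => [/eqP|k].
  by rewrite mulf_eq0 (negbTE (A0 i)) => /eqP.
rewrite -val_eqE/= neq_ltn => /orP[ki|ik]; last by rewrite tA ?mul0r.
by rewrite IH ?mulr0//; [exact: leq_trans ki ni|exact: ltn_trans ki ij].
Qed.

Lemma tril_trig A : is_trig_mx (tril A).
Proof.
apply/is_trig_mxP => i j ij; rewrite mxE ltnNge (ltnW ij)/=.
by rewrite -val_eqE/= ltn_eqF.
Qed.

Lemma tril_diag A i : tril A i i = A i i / 2.
Proof. by rewrite mxE ltnn eqxx. Qed.

(** On the diagonal [a * (a / 2)] is twice the square of [a / 2]; the second copy pays for the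
    logarithm in the descent estimate. *)
Lemma mxdot_tril A :
  mxdot A (tril A) = mxdot (tril A) (tril A) + \sum_i tril A i i ^+ 2.
Proof.
rewrite -big_split/=; apply: eq_bigr => i _.
rewrite [in LHS](bigD1 i)//= [in RHS](bigD1 i)//= !tril_diag addrAC.
congr (_ + _); first by field.
apply: eq_bigr => j ji; rewrite !mxE.
by case: ifP => // _; rewrite eq_sym (negbTE ji) !mulr0.
Qed.

Lemma ln_det_trig A : is_trig_mx A -> (forall i, 0 < A i i) ->
  ln (\det A) = \sum_i ln (A i i).
Proof.
move=> tA A0; rewrite det_trig//.
(* Positivity of the partial products is carried along because [lnM] requires it. *)
suff : 0 < \prod_i A i i /\ ln (\prod_i A i i) = \sum_i ln (A i i) by case.
elim/big_rec2: _ => [|i x y _ [y0 yE]]; first by rewrite ln1.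
by rewrite mulr_gt0// lnM ?posrE// yE.
Qed.

Lemma trig_scalarB A (a : R) : is_trig_mx A -> is_trig_mx (1%:M - a *: A).
Proof.
move=> /is_trig_mxP tA; apply/is_trig_mxP => i j ij.
by rewrite !mxE tA// -val_eqE/= ltn_eqF// mulr0 subr0.
Qed.

End triangular_matrices.

(** * One step of the algorithm *)

Lemma mxB1_diag {R : pzRingType} {n} (A : 'M[R]_n) i :
  (A - 1%:M) i i = A i i - 1.
Proof. by rewrite !mxE eqxx. Qed.

Lemma mx1BZ_diag {R : pzRingType} {n} (a : R) (A : 'M[R]_n) i :
  (1%:M - a *: A) i i = 1 - a * A i i.
Proof. by rewrite !mxE eqxx. Qed.

Lemma dot_young {R : realType} {d} (a : R) (x y : 'cV[R]_d) :
  2 * a * (- dot x y - a / 2 * dot y y) <= dot x x.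
Proof.
have := dot_ge0 (x + a *: y).
have -> : dot (x + a *: y) (x + a *: y) =
    dot x x - 2 * a * (- dot x y - a / 2 * dot y y).
  rewrite dotDr !(dotC (x + _)) !dotDr !dotZr !dotZl (dotC y x).
  by field.
by rewrite subr_ge0.
Qed.

Section one_step.
Context {R : realType} {d : nat}.
Variables (l : 'cV[R]_d -> R) (delta M : R).
Hypothesis l_C2 : C2 l.
Hypothesis M_gt0 : 0 < M.
Hypothesis delta_gt0 : 0 < delta.
Hypothesis hess_bounds : forall x,
  loewner_le delta%:M (hess l x) /\ loewner_le (hess l x) M%:M.

Variables (m : 'cV[R]_d) (C : 'M[R]_d) (lam U rho : R).
Hypothesis mC : Omega (m, C).
Hypothesis lam_gt0 : 0 < lam.
Hypothesis V_lower : loewner_le lam%:M (C *m C^T).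
Hypothesis C_norm : mxdot C C <= U.

Let g := gauss_E_mx m (C *m C^T) (grad l).
Let H := gauss_E_mx m (C *m C^T) (hess l).
Let S := C^T *m H *m C - 1%:M.
Let T := tril S.
Let Q := mxdot S T.

Let trigC : is_trig_mx C. Proof. by case: mC. Qed.
Let C_diag i : 0 < C i i. Proof. by have [_] := mC; exact. Qed.
Let uC : C \in unitmx.
Proof. by rewrite unitmxE unitfE gt_eqF// (Omega_det_gt0 mC). Qed.

(** [S i i + 1] is [<c, H c>] for the [i]-th column [c] of [C], and [|c|^2] lies between [lam] and
    [U]. *)
Lemma one_step_S_diag i : delta * lam - 1 <= S i i <= M * U - 1.
Proof.
have E : (C^T *m (H *m C)) i i = dot (col i C) (H *m col i C).
  rewrite -col_mulmx mxE; apply: eq_bigr => k _.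
  by rewrite [C^T _ _]mxE [col i C _ _]mxE [col i (_ *m _) _ _]mxE.
have SE : S i i = dot (col i C) (H *m col i C) - 1.
  by rewrite /S -mulmxA mxB1_diag E.
have /andP[h1 h2] := mean_hess_bounds l_C2 M_gt0 delta_gt0 hess_bounds mC (col i C).
have d1 : dot (col i C) (col i C) <= U.
  apply: le_trans C_norm; rewrite mxdot_col (bigD1 i)//= lerDl.
  by apply: sumr_ge0 => j _; exact: dot_ge0.
have d2 : lam <= dot (col i C) (col i C).
  have := dot_mulmx_ge (delta_mx i 0) uC (ltW lam_gt0) V_lower.
  rewrite -colE; apply: le_trans.
  rewrite (_ : dot _ _ = 1) ?mulr1// /dot (bigD1 i)//= big1 ?addr0 => [|k ki].
    by rewrite mxE !eqxx mulr1.
  by rewrite mxE (negbTE ki) mul0r.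
rewrite SE; apply/andP; split.
  have : delta * lam <= delta * dot (col i C) (col i C) by rewrite ler_pM2l.
  by move: h1; rewrite -/H; lra.
have : M * dot (col i C) (col i C) <= M * U by rewrite ler_pM2l.
by move: h2; rewrite -/H; lra.
Qed.

(** The trace produced here cancels the first-order part of [- ln det]. *)
Let mxdot_HC A : mxdot (H *m C) (C *m A) = mxdot S A + \sum_i A i i.
Proof. by rewrite mxdot_mulmx -mxdot1 -mxdotDl /S subrK mulmxA. Qed.

Let QE : Q = mxdot T T + \sum_i T i i ^+ 2.
Proof. exact: mxdot_tril. Qed.

Lemma one_step_gap (m' : 'cV[R]_d) (C' : 'M[R]_d) : Omega (m', C') ->
  delta * lam <= 1 ->
  2 * delta * (VI_loss l (m, C) - VI_loss l (m', C')) <= dot g g + Q / lam.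
Proof.
move=> mC' mu1; have [/= trigC' C'_diag] := mC'.
pose mu := delta * lam; have mu0 : 0 < mu by exact: mulr_gt0.
pose Y := invmx C *m C'; pose X := 1%:M - Y.
have CY : C *m Y = C' by rewrite mulKVmx.
have trigY : is_trig_mx Y.
  apply: (@trig_mulmxV _ _ C) => //; last by rewrite CY.
  by move=> i; rewrite gt_eqF.
have Y_diag i : 0 < Y i i.
  by rewrite -(pmulr_rgt0 _ (C_diag i)) -trig_mulmx_diag// CY.
have CX : C' - C = - (C *m X) by rewrite mulmxBr mulmx1 CY opprB.
have trigX : is_trig_mx X by have := trig_scalarB 1 trigY; rewrite scale1r.
have Xii i : Y i i = 1 - X i i by rewrite !mxE eqxx subKr.
have ldet : ln (\det C') - ln (\det C) = \sum_i ln (1 - X i i).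
  rewrite -CY det_mulmx lnM ?posrE ?(Omega_det_gt0 mC)//; last first.
    by rewrite det_trig// prodr_gt0.
  rewrite addrAC subrr add0r ln_det_trig//.
  by apply: eq_bigr => i _; rewrite Xii.
have /andP[eb _] := energy_bounds l_C2 M_gt0 delta_gt0 hess_bounds mC
  (erefl (dot (m' - m) (m' - m) + mxdot (C' - C) (C' - C))) erefl.
have LE := VI_loss_energy l_C2 M_gt0 delta_gt0 hess_bounds.
rewrite (LE _ _ mC) (LE _ _ mC').
move: eb; rewrite -/g -/H; set D := m' - m => eb.
have gm : 2 * delta * (- dot g D - delta / 2 * dot D D) <= dot g g.
  exact: dot_young.
have CXX : mxdot (C' - C) (C' - C) = mxdot (C *m X) (C *m X).
  by rewrite CX -scaleN1r mxdotZr mxdotC mxdotZr; ring.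
have HCX : mxdot (H *m C) (C' - C) = - (mxdot S X + \sum_i X i i).
  by rewrite CX -scaleN1r mxdotZr mxdot_HC mulN1r.
have lX := mxdot_mulmx_ge X uC (ltW lam_gt0) V_lower.
(* The maximization over [X] splits into entries. Below the diagonal [T i j = S i j] and a square is
   completed; on it, [log_barrier_conjugate] gives half as much, matching the halved diagonal of
   [T]; above it, [X] and [T] vanish. *)
have key : mxdot S X + \sum_i X i i + \sum_i ln (1 - X i i)
    - mu / 2 * mxdot X X <= Q / (2 * mu).
  rewrite /Q /mxdot mulr_sumr mulr_suml -sumrN -!big_split/=.
  apply: ler_sum => i _; rewrite mulr_sumr mulr_suml.
  rewrite !(bigD1 (P := predT) i)//=.
  have diag : S i i * X i i + X i i + ln (1 - X i i) - mu / 2 * X i i ^+ 2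
      <= S i i * T i i / (2 * mu).
    rewrite /T tril_diag (_ : _ / (2 * mu) = S i i ^+ 2 / (4 * mu)); last first.
      by field; rewrite gt_eqF.
    have /andP[Smu _] := one_step_S_diag i.
    by apply: log_barrier_conjugate => //; have := Y_diag i; rewrite Xii; lra.
  have off : \sum_(j | j != i) S i j * X i j -
      \sum_(j | j != i) mu / 2 * (X i j * X i j) <=
      \sum_(j | j != i) S i j * T i j / (2 * mu).
    rewrite -sumrB; apply: ler_sum => j; rewrite -val_eqE/= neq_ltn => /orP[ji|ij].
      have -> : T i j = S i j by rewrite [LHS]mxE ji.
      have mu20 : 0 < mu / 2 by rewrite divr_gt0.
      have := quad_max (S i j) (X i j) mu20.
      by rewrite -!expr2 (_ : 4 * (mu / 2) = 2 * mu)//; field.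
    have -> : X i j = 0 by exact: (is_trig_mxP trigX).
    have -> : T i j = 0 by exact: (is_trig_mxP (tril_trig S)).
    by rewrite !mulr0 mul0r subr0.
  lra.
have Ql : Q / lam = 2 * delta * (Q / (2 * mu)).
  by rewrite /mu; field; rewrite !gt_eqF.
have d2 : 0 < 2 * delta by rewrite mulr_gt0.
have step : - dot g D - delta / 2 * dot D D + Q / (2 * mu) >=
    energy l m C - energy l m' C' + (ln (\det C') - ln (\det C)).
  have : delta / 2 * (lam * mxdot X X) <= delta / 2 * mxdot (C *m X) (C *m X).
    by rewrite ler_pM2l// divr_gt0.
  by rewrite ldet; move: eb; rewrite CXX HCX; rewrite /mu in key *; lra.
have := ler_wpM2l (ltW d2) step; rewrite Ql; lra.
Qed.

Hypothesis rho_gt0 : 0 < rho.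
Let m' := m - rho *: (C *m C^T *m g).
Let C' := C - rho *: (C *m T).

Let CE : C' = C *m (1%:M - rho *: T).
Proof. by rewrite mulmxBr mulmx1 -scalemxAr. Qed.

Lemma one_step_diag i : C' i i = C i i * (1 - rho * (S i i / 2)).
Proof.
rewrite CE trig_mulmx_diag ?mx1BZ_diag// /T ?tril_diag//.
exact/trig_scalarB/tril_trig.
Qed.

(** Smoothness of the energy costs [M U rho^2 / 2] times [<T, T>], and the barrier, by
    [log_barrier_smooth] with [p = M U], costs the same multiple of the squared diagonal of [T]. By
    [mxdot_tril] the two add up to a multiple of [Q]. *)
Lemma one_step_descent : Omega (m', C') -> 1 <= M * U -> rho * (M * U) <= 2 ->
  (rho * lam - M * rho ^+ 2 * U ^+ 2 / 2) * dot g g +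
  (rho - M * U * rho ^+ 2 / 2) * Q <= VI_loss l (m, C) - VI_loss l (m', C').
Proof.
move=> mC' p1 rp.
have barrier i := log_barrier_smooth rho_gt0 p1 rp (andP (one_step_S_diag i)).2.
have trig1 : is_trig_mx (1%:M - rho *: T) by exact/trig_scalarB/tril_trig.
have pos1 i : 0 < (1%:M - rho *: T) i i.
  by rewrite mx1BZ_diag /T tril_diag; have [] := barrier i.
have ldet : ln (\det C') - ln (\det C) = \sum_i ln (1 - rho * T i i).
  rewrite CE det_mulmx lnM ?posrE ?(Omega_det_gt0 mC)//; last first.
    by rewrite det_trig// prodr_gt0.
  rewrite addrAC subrr add0r ln_det_trig//.
  by apply: eq_bigr => i _; rewrite mx1BZ_diag.
have lnT : - (M * U / 2 * (rho ^+ 2 * \sum_i T i i ^+ 2)) <=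
    \sum_i ln (1 - rho * T i i) + rho * \sum_i T i i.
  rewrite !mulr_sumr -sumrN -big_split/=; apply: ler_sum => i _.
  rewrite /T tril_diag; have [_] := barrier i; rewrite exprMn; lra.
have /andP[_ eb] := energy_bounds l_C2 M_gt0 delta_gt0 hess_bounds mC
  (erefl (dot (m' - m) (m' - m) + mxdot (C' - C) (C' - C))) erefl.
have LE := VI_loss_energy l_C2 M_gt0 delta_gt0 hess_bounds.
rewrite (LE _ _ mC) (LE _ _ mC').
have Dm : m' - m = (- rho) *: (C *m (C^T *m g)).
  by rewrite /m' addrAC subrr add0r scaleNr mulmxA.
have DC : C' - C = (- rho) *: (C *m T) by rewrite /C' addrAC subrr add0r scaleNr.
have HCT : mxdot (H *m C) (C' - C) = - rho * (Q + \sum_i T i i).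
  by rewrite DC mxdotZr mxdot_HC.
have CC : mxdot (C' - C) (C' - C) = rho ^+ 2 * mxdot (C *m T) (C *m T).
  by rewrite DC mxdotZr mxdotC mxdotZr; ring.
have gD : dot g (m' - m) = - rho * dot g (C *m C^T *m g) by rewrite Dm dotZr mulmxA.
have DD : dot (m' - m) (m' - m) =
    rho ^+ 2 * dot (C *m (C^T *m g)) (C *m (C^T *m g)).
  by rewrite Dm dotZr dotZl; ring.
have gVg : lam * dot g g <= dot g (C *m C^T *m g).
  by rewrite -dot_scalar_mx; exact: ((loewner_leE _ _).1 V_lower).
have VgVg : dot (C *m (C^T *m g)) (C *m (C^T *m g)) <= U ^+ 2 * dot g g.
  apply: le_trans (dot_mulmx_le _ _) _; rewrite expr2 -mulrA.
  apply: ler_pM => //; [exact: mxdot_ge0|exact: dot_ge0|].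
  apply: le_trans (dot_mulmx_le _ _) _; rewrite mxdot_tr.
  by rewrite ler_wpM2r// dot_ge0.
have CTCT : mxdot (C *m T) (C *m T) <= U * mxdot T T.
  apply: le_trans (mxdot_mulmx_le _ _) _.
  by rewrite ler_wpM2r// mxdot_ge0.
have r2 : 0 <= M / 2 * rho ^+ 2 by rewrite mulr_ge0 ?sqr_ge0// divr_ge0// ltW.
have h1 := ler_wpM2l r2 VgVg; have h2 := ler_wpM2l r2 CTCT.
have h3 : rho * (lam * dot g g) <= rho * dot g (C *m C^T *m g) by rewrite ler_pM2l.
move: eb; rewrite -/g -/H DD CC gD HCT => eb.
have step : energy l m' C' - energy l m C <=
    - rho * (lam * dot g g) - rho * Q - rho * \sum_i T i i +
    M / 2 * rho ^+ 2 * (U ^+ 2 * dot g g) + M / 2 * rho ^+ 2 * (U * mxdot T T) by lra.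
have -> : (rho - M * U * rho ^+ 2 / 2) * Q = rho * Q -
    M * U * rho ^+ 2 / 2 * (mxdot T T + \sum_i T i i ^+ 2) by rewrite -QE; ring.
lra.
Qed.

End one_step.

(** * Trajectory *)

Section trajectory.
Context {R : realType}.

(** A linear decrement is enough to contradict boundedness, so the geometric behaviour of the
    diagonal is only used through its first step. *)
Lemma no_linear_descent (u : nat -> R) (k : R) : 0 < k ->
  (forall t, u t.+1 <= u t - k) -> ~ (forall t, 0 <= u t).
Proof.
move=> k0 uk u0; have ut t : u t <= u 0%N - k * t%:R.
  elim: t => [|t IH]; first by rewrite mulr0 subr0.
  by apply: le_trans (uk t) _; rewrite -natr1; lra.
have := archi_boundP (divr_ge0 (u0 0%N) (ltW k0)).
rewrite ltr_pdivrMr// mulrC => h.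
by have := u0 (Num.bound (u 0%N / k)); have := ut (Num.bound (u 0%N / k)); lra.
Qed.

Lemma dot_delta d (i : 'I_d) : dot (delta_mx i 0) (delta_mx i 0) = 1 :> R.
Proof.
rewrite /dot (bigD1 i)//= big1 ?addr0 => [|k ki].
  by rewrite mxE !eqxx mulr1.
by rewrite mxE (negbTE ki) mul0r.
Qed.

Lemma sqr_le_mxdot d (A : 'M[R]_d) i j : A i j ^+ 2 <= mxdot A A.
Proof.
rewrite /mxdot (bigD1 i)//= (bigD1 j)//= -expr2 -addrA lerDl addr_ge0//.
  by apply: sumr_ge0 => k _; rewrite -expr2 sqr_ge0.
by apply: sumr_ge0 => k _; apply: sumr_ge0 => h _; rewrite -expr2 sqr_ge0.
Qed.

Lemma frobenius_norm_sqr d (A : 'M[R]_d) : frobenius_norm A ^+ 2 = mxdot A A.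
Proof.
rewrite sqr_sqrtr; last first.
  by apply: sumr_ge0 => i _; apply: sumr_ge0 => j _; exact: sqr_ge0.
by apply: eq_bigr => i _; apply: eq_bigr => j _; rewrite expr2.
Qed.

Variables (n : nat) (l : 'cV[R]_n.+1 -> R) (delta M lam U rho : R).
Variables (m : nat -> 'cV[R]_n.+1) (C : nat -> 'M[R]_n.+1).
Hypothesis l_C2 : C2 l.
Hypothesis M_gt0 : 0 < M.
Hypothesis delta_gt0 : 0 < delta.
Hypothesis hess_bounds : forall x,
  loewner_le delta%:M (hess l x) /\ loewner_le (hess l x) M%:M.
Hypothesis rho_gt0 : 0 < rho.
Hypothesis iter_Omega : forall t, Omega (m t, C t).
Hypothesis C_step : forall t, C t.+1 =
  C t - rho *: (C t *m
    tril ((C t)^T *m gauss_E_mx (m t) (C t *m (C t)^T) (hess l) *m C t - 1%:M)).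
Hypothesis lam_gt0 : 0 < lam.
Hypothesis V_lower : forall t, loewner_le lam%:M (C t *m (C t)^T).
Hypothesis C_norm : forall t, mxdot (C t) (C t) <= U.

(** The last diagonal entry is singled out because it is the only nonzero entry of its column, so
    that [lam] bounds its square from below. *)
Let c t := C t ord_max ord_max.

Let c_gt0 t : 0 < c t. Proof. by have [_] := iter_Omega t; exact. Qed.

Let uC t : C t \in unitmx.
Proof. by rewrite unitmxE unitfE gt_eqF// (Omega_det_gt0 (iter_Omega t)). Qed.

Let c_step t : exists s, [/\ delta * lam - 1 <= s, s <= M * U - 1 &
  c t.+1 = c t * (1 - rho * (s / 2))].
Proof.
have /andP[h1 h2] := one_step_S_diag l_C2 M_gt0 delta_gt0 hess_bounds
  (iter_Omega t) lam_gt0 (V_lower t) (C_norm t) ord_max.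
eexists; split; [exact: h1|exact: h2|].
by rewrite /c C_step; apply: one_step_diag => //; exact: iter_Omega.
Qed.

(** Both bounds are tested on one unit vector: [lam <= |C e|^2 <= U]. *)
Lemma lam_le_norm : lam <= U.
Proof.
apply: le_trans (C_norm 0); have e1 := dot_delta (ord_max : 'I_n.+1).
have := dot_mulmx_ge (delta_mx ord_max 0) (uC 0) (ltW lam_gt0) (V_lower 0).
rewrite e1 mulr1 => h; apply: le_trans h _.
by apply: le_trans (dot_mulmx_le _ _) _; rewrite e1 mulr1.
Qed.

Let c_lower t : Num.sqrt lam <= c t.
Proof.
rewrite -(gtr0_norm (c_gt0 t)) -sqrtr_sqr ler_wsqrtr//.
have := dot_mulmx_ge (delta_mx ord_max 0) (uC t) (ltW lam_gt0) (V_lower t).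
rewrite dot_delta mulr1 -colE => /le_trans; apply.
have [/= /is_trig_mxP tC _] := iter_Omega t.
rewrite /dot (bigD1 ord_max)//= big1 ?addr0 => [|k kn].
  by rewrite !mxE -expr2.
by rewrite !mxE tC ?mul0r// ltn_neqAle -ltnS ltn_ord andbT.
Qed.

(* Otherwise every diagonal entry of [C t] would decay geometrically. *)
Lemma delta_lam_le1 : delta * lam <= 1.
Proof.
rewrite leNgt; apply/negP => mu1; pose k := rho * ((delta * lam - 1) / 2).
have k0 : 0 < k by rewrite mulr_gt0// divr_gt0// subr_gt0.
(* By [c_lower], a relative decrease by [k] is at least the constant [k * Num.sqrt lam]. *)
apply: (@no_linear_descent c (k * Num.sqrt lam)); last by move=> t; exact: ltW.
  by rewrite mulr_gt0// sqrtr_gt0.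
move=> t; have [s [s1 _ ->]] := c_step t.
have : k * Num.sqrt lam <= k * c t by rewrite ler_pM2l.
have : c t * k <= c t * (rho * (s / 2)).
  by rewrite ler_pM2l// ler_pM2l//; lra.
lra.
Qed.

(* Otherwise every diagonal entry of [C t] would grow geometrically. *)
Lemma M_norm_ge1 : 1 <= M * U.
Proof.
rewrite leNgt; apply/negP => p1; pose k := rho * ((1 - M * U) / 2).
have k0 : 0 < k by rewrite mulr_gt0// divr_gt0// subr_gt0.
have cS t : c t + c t * k <= c t.+1.
  have [s [_ s1 ->]] := c_step t.
  have : c t * (rho * (s / 2)) <= c t * - k.
    by rewrite ler_pM2l// /k -mulrN ler_pM2l//; lra.
  lra.
have c0 t : c 0 <= c t.
  elim: t => // t /le_trans; apply; apply: le_trans (cS t).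
  by rewrite lerDl mulr_ge0// ltW.
(* This sequence is nonnegative because [c^2 <= U] and [2 c <= c^2 + 1]. It drops by at least
   [c 0 * k] at each step, since [c] never falls below its initial value. *)
apply: (@no_linear_descent (fun t => U + 1 - c t) (c 0 * k)).
- by rewrite mulr_gt0.
- move=> t; have : c 0 * k <= c t * k by rewrite ler_pM2r.
  have := cS t; lra.
- move=> t; have := le_trans (sqr_le_mxdot (C t) ord_max ord_max) (C_norm t).
  rewrite -/(c t); have := sqr_ge0 (c t - 1); have := c_gt0 t; nra.
Qed.

End trajectory.

(** * Linear convergence of the loss *)

Theorem theorem2 (R : realType) (d : nat) (l : 'cV[R]_d -> R) (delta M : R)
    (m_star : 'cV[R]_d) (C_star : 'M[R]_d)
    (m : nat -> 'cV[R]_d) (C : nat -> 'M[R]_d)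
    (c0 rho xi_l xi_u lambda_min eta : R)
  (l_C2 : C2 l)
  (delta_gt0 : 0 < delta) (delta_le_M : delta <= M)
  (hess_bounds : forall theta : 'cV[R]_d,
    loewner_le delta%:M (hess l theta) /\ loewner_le (hess l theta) M%:M)
  (star_Omega : Omega (m_star, C_star))
  (star_min : forall p, Omega p -> VI_loss l (m_star, C_star) <= VI_loss l p)
  (c0_gt0 : 0 < c0) (C_init : C 0%N = c0%:M)
  (rho_gt0 : 0 < rho)
  (iter_Omega : forall t, Omega (m t, C t))
  (C_step : forall t, C t.+1 =
    C t - rho *: (C t *m
      tril ((C t)^T *m gauss_E_mx (m t) (C t *m (C t)^T) (hess l) *m C t
            - 1%:M)))
  (m_step : forall t, m t.+1 =
    m t - rho *: (C t *m (C t)^T *m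
      gauss_E_mx (m t) (C t *m (C t)^T) (grad l)))
  (xi_l_gt0 : 0 < xi_l) (xi_l_le_u : xi_l <= xi_u)
  (lambda_min_gt0 : 0 < lambda_min)
  (C_norm : forall t, xi_l <= frobenius_norm (C t) <= xi_u)
  (V_lower : forall t, loewner_le lambda_min%:M (C t *m (C t)^T))
  (eta_def : eta =
    Num.min (lambda_min * rho - M * rho ^+ 2 * xi_u ^+ 4 / 2)
            (Num.sqrt (5 / 2) * rho * xi_l ^+ 2
             - 5 * rho ^+ 2 * xi_u ^+ 4 * M / 4))
  (rate_gt0 : 0 < 1 - 2 * eta * delta)
  (rate_lt1 : 1 - 2 * eta * delta < 1) :
  forall t : nat,
    VI_loss l (m t.+1, C t.+1) - VI_loss l (m_star, C_star)
    <= (1 - 2 * eta * delta) ^+ t.+1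
       * (VI_loss l (m 0%N, C 0%N) - VI_loss l (m_star, C_star)).
Proof.
have eta_gt0 : 0 < eta by have : 0 < eta * delta by [lra]; rewrite pmulr_lgt0.
have eta_le : eta <= lambda_min * rho - M * rho ^+ 2 * xi_u ^+ 4 / 2.
  by rewrite eta_def ge_min lexx.

have M_gt0 : 0 < M by exact: lt_le_trans delta_le_M.
(* In dimension 0 the Frobenius norm is 0, against [xi_l > 0]; otherwise there is a last diagonal
   entry. *)
case: d => [|n] in l m_star C_star m C l_C2 hess_bounds star_Omega star_min
  C_init iter_Omega C_step m_step C_norm V_lower *.
  have /andP[+ _] := C_norm 0%N.
  by rewrite /frobenius_norm big_ord0 sqrtr0 leNgt xi_l_gt0.
pose U := xi_u ^+ 2.
have xi_u_gt0 : 0 < xi_u by exact: lt_le_trans xi_l_le_u.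
have CU t : mxdot (C t) (C t) <= U.
  rewrite -frobenius_norm_sqr lerXn2r ?nnegrE ?sqrtr_ge0 ?(ltW xi_u_gt0)//.
  by have /andP[] := C_norm t.
have lamU := lam_le_norm iter_Omega lambda_min_gt0 V_lower CU.
have mu1 := delta_lam_le1 l_C2 M_gt0 delta_gt0 hess_bounds rho_gt0 iter_Omega
  C_step lambda_min_gt0 V_lower CU.
have p1 := M_norm_ge1 l_C2 M_gt0 delta_gt0 hess_bounds rho_gt0 iter_Omega
  C_step lambda_min_gt0 V_lower CU.
have U4 : xi_u ^+ 4 = U ^+ 2 by rewrite /U -exprM.
rewrite U4 in eta_le.
have U_gt0 : 0 < U by exact: exprn_gt0.
(* Positivity of [eta] gives [M rho U^2 / 2 < lambda_min <= U], and one factor [U] is divided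
   out. *)
have rp : rho * (M * U) <= 2.
  have h : 0 < rho * (lambda_min - M * rho * U ^+ 2 / 2) by lra.
  have {}h : M * rho * U ^+ 2 < 2 * U.
    by move: h; rewrite (pmulr_rgt0 _ rho_gt0); lra.
  rewrite ltW// -(ltr_pM2r U_gt0); lra.
(* The gap bound, taken at [(m_star, C_star)] and multiplied by [eta], is absorbed term by term by
   the descent bound. *)
have step t : VI_loss l (m t.+1, C t.+1) - VI_loss l (m_star, C_star) <=
    (1 - 2 * eta * delta) * (VI_loss l (m t, C t) - VI_loss l (m_star, C_star)).
  have oS := iter_Omega t.+1; rewrite m_step C_step in oS.
  have desc := one_step_descent l_C2 M_gt0 delta_gt0 hess_bounds (iter_Omega t)
    lambda_min_gt0 (V_lower t) (CU t) rho_gt0 oS p1 rp.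
  have gap := one_step_gap l_C2 M_gt0 delta_gt0 hess_bounds (iter_Omega t)
    lambda_min_gt0 (V_lower t) (CU t) star_Omega mu1.
  rewrite -C_step -m_step in desc.
  set L := VI_loss l (m t, C t) in desc gap *.
  set L' := VI_loss l (m_star, C_star) in gap *.
  set Q := mxdot _ _ in desc gap; set gg := dot _ _ in desc gap.
  have Q0 : 0 <= Q.
    rewrite /Q mxdot_tril addr_ge0 ?mxdot_ge0// sumr_ge0// => i _.
    exact: sqr_ge0.
  have gg0 : 0 <= gg by exact: dot_ge0.
  (* [eta / lambda_min] is at most [rho - M rho^2 U^2 / (2 lambda_min)], and
     [U / lambda_min >= 1]. *)
  have etaQ : eta * (Q / lambda_min) <= (rho - M * U * rho ^+ 2 / 2) * Q.
    rewrite mulrCA mulrC ler_wpM2r// ler_pdivrMr//.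
    have : M * U * rho ^+ 2 / 2 * lambda_min <= M * U * rho ^+ 2 / 2 * U.
      by rewrite ler_wpM2l// divr_ge0// !mulr_ge0 ?sqr_ge0 ?ltW.
    lra.
  have etag : eta * gg <= (rho * lambda_min - M * rho ^+ 2 * U ^+ 2 / 2) * gg.
    by rewrite ler_wpM2r//; lra.
  have := ler_wpM2l (ltW eta_gt0) gap; lra.
elim=> [|t IH]; first by rewrite expr1.
apply: le_trans (step t.+1) _.
by rewrite exprS -[leRHS]mulrA ler_pM2l.
Qed.
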